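(* Let $\theta>0$ and let $X$ have the beta$(\theta,1)$ distribution, with density $\theta x^{\theta-1}$ on $[0,1]$. Consider the record process with factor $X$ and initial state $R_0=1$. Then for all $s>0$ and $T>s$, the value $v(T,s)$ of the policy $\pi_s$ is $$v(T,s)=\Gamma(-\theta+1,s,T)\,e^s s^\theta\,p_1'(s)+p_1(s),$$ where $$p_1(s)=\int_0^1\frac{e^{-sx}-e^{-s}}{1-x}\,\theta x^{\theta-1}\,dx,\qquad p_1'(s)=-p_1(s)+\frac{\theta}{s^\theta}\,\Gamma(\theta,0,s).$$ In particular, if $s_*$ is the unique positive solution of $\mathbb{E}\left[\frac{e^{s(1-X)}-1}{1-X}\right]=1$, then for all $T\ge s_*$ the optimal probability of stopping at the last record before $T$ is $$v(T,s_* )=\Gamma(-\theta+1,s_*,T)\left[-s_*^\theta+e^{s_*}\,\theta\,\Gamma(\theta,0,s_* )\right]+e^{-s_*},$$ and the limit optimal probability $v(\infty,s_* )=\lim_{T\to\infty}v(T,s_* )$ is given by the same formula with $\Gamma(-\theta+1,s_*,T)$ replaced by $\Gamma(-\theta+1,s_*,\infty)=\int_{s_*}^\infty e^{-t}t^{-\theta}\,dt$.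
   Context: Incomplete gamma function: $\Gamma(a,b,c)=\int_b^c e^{-t}t^{a-1}\,dt$. The record process with factor $X$ is the nonincreasing right-continuous Markov jump process $R=(R_t,\ t\ge0)$ which, when in state $r>0$, jumps at rate $r$ to a new state $rX'$, where $X'$ is a fresh independent copy of $X$. Equivalently, starting from $R_0=r_0$, the successive states after the jumps are $r_0X_1,\ r_0X_1X_2,\ldots$ and the successive sojourn times are $E_1/r_0,\ E_2/(r_0X_1),\ E_3/(r_0X_1X_2),\ldots$, where the $X_j$ are i.i.d. copies of $X$ and the $E_j$ are i.i.d. unit exponential variables independent of the $X_j$. A record occurs at time $t>0$ if $t$ is a jump time of $R$; time $0$ is not a record time. For a horizon $T>0$ and $s>0$, $\pi_s$ is the policy that stops at the first record time $t<T$ with $(T-t)R_t\le s$ (and does not stop, hence does not succeed, if there is no such record time). With $R_0=1$, the value $v(T,s)$ is the probability that $\pi_s$ stops at the last record before $T$, $$v(T,s)=\mathbb{P}(R_{\pi_s-}>R_{\pi_s}=R_T,\ \pi_s<T);$$ equivalently, it is the probability that exactly one record time $t<T$ satisfies $(T-t)R_t\le s$. The optimal probability is the maximum of $\mathbb{P}(R_{\pi-}>R_\pi=R_T,\ \pi<T)$ over all stopping times $\pi$ of the natural right-continuous filtration of $R$; it is attained by $\pi_{s_*}$. The function $p_1(s)$ is the probability that exactly one record occurs before horizon $s$ when $R_0=1$, and $p_1'$ is its derivative. *)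

(* Defs.v *)
From HB Require Import structures.
From mathcomp Require Import all_boot all_order all_algebra.
From mathcomp Require Import all_classical all_reals all_analysis.

Set Implicit Arguments.
Unset Strict Implicit.
Unset Printing Implicit Defensive.

Import Order.TTheory GRing.Theory Num.Theory.
Import numFieldNormedType.Exports.

Local Open Scope classical_set_scope.
Local Open Scope ring_scope.

(* Gamma(a,b,c), where b and c may be infinite. *)
Definition inc_gamma (R : realType) (a : R) (b c : \bar R) : R :=
  \int[lebesgue_measure]_(t in [set t : R | (b < t%:E < c)%E])
    (expR (- t) * t `^ (a - 1)).

(* The library's [beta_prob] only covers parameters in nat. *)
Definition beta1_pdf (R : realType) (theta : R) : R -> R :=
  (fun x => theta * x `^ (theta - 1)) \_ `[0, 1].

Definition beta1_prob (R : realType) (theta : R) (A : set R) : \bar R :=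
  (\int[lebesgue_measure]_(x in A) (beta1_pdf theta x)%:E)%E.

Definition mutually_independent (d : measure_display) (Omega : measurableType d)
    (R : realType) (P : probability Omega R) (I : choiceType)
    (Y : I -> Omega -> R) : Prop :=
  forall (J : seq I) (B : I -> set R), uniq J ->
    (forall i, measurable (B i)) ->
    P (\bigcap_(i in [set` J]) Y i @^-1` B i) =
    (\prod_(i <- J) P (Y i @^-1` B i))%E.

Section record_process.
Context (Omega : Type) (R : realType).
Variables (r0 : R) (X E : nat -> Omega -> R).

Definition state (n : nat) (w : Omega) : R := r0 * \prod_(j < n) X j w.

(* Time of the [n]-th jump, with [jump_time 0 = 0]. Once the state is 0 it
   stays 0, so the sojourn times [E k w / 0 = 0] do no harm. *)
Definition jump_time (n : nat) (w : Omega) : R :=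
  \sum_(k < n) E k w / state k w.

(* For 0 <= X <= 1 and 0 <= E the states decrease and the jump times increase,
   so for t >= 0 this is [state n w] on [jump_time n w, jump_time n.+1 w), see
   [record_processE]. Taking the infimum makes every path nonincreasing and
   right-continuous on [0, +oo), even on the null event where the jump times
   accumulate. *)
Definition record_process (t : R) (w : Omega) : R :=
  inf [set state n w | n in [set n | jump_time n w <= t]].

Lemma record_processE (n : nat) (t : R) (w : Omega) :
  0 <= r0 -> (forall k, 0 <= X k w <= 1) -> (forall k, 0 <= E k w) ->
  jump_time n w <= t < jump_time n.+1 w -> record_process t w = state n w.
Proof.
move=> r0_ge0 X01 E_ge0 /andP[tn tn1].
have S_ge0 k : 0 <= state k w.
  by apply: mulr_ge0 => //; apply: prodr_ge0 => j _; case/andP: (X01 j).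
have S_dec : {homo state ^~ w : i j / (i <= j)%N >-> j <= i}.
  apply: homo_leq => [//|x y z yx zy|i]; first exact: (le_trans zy yx).
  rewrite /state big_ord_recr/= mulrA ler_piMr//; first exact: S_ge0.
  by case/andP: (X01 i).
have tau_inc : {homo jump_time ^~ w : i j / (i <= j)%N >-> i <= j}.
  apply: homo_leq => [//|x y z|i]; first exact: le_trans.
  by rewrite /jump_time big_ord_recr/= lerDl divr_ge0.
apply/le_anti/andP; split.
- apply: ge_inf; last by exists n.
  by exists 0 => _ [k _ <-].
- apply: lb_le_inf; first by exists (state n w), n.
  move=> _ [k/= tk <-]; apply: S_dec; rewrite leqNgt; apply/negP => nk.
  by have := lt_le_trans tn1 (tau_inc _ _ nk); rewrite ltNge tk.
Qed.

End record_process.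

Section stopping.
Context (d : measure_display) (Omega : measurableType d) (R : realType).
Variables (P : probability Omega R) (Z : R -> Omega -> R).

Definition record_at (t : R) (w : Omega) : Prop :=
  0 < t /\ Z t w < lim (Z u w @[u --> t^'-]).

Definition natural_filtration (t : R) : set (set Omega) :=
  <<s \bigcup_(u in `[0, t]) preimage_set_system setT (Z u) measurable >>.

Definition right_filtration (t : R) : set (set Omega) :=
  \bigcap_(u in `]t, +oo[) natural_filtration u.

Definition stopping_time (pi : Omega -> \bar R) : Prop :=
  (forall w, (0 <= pi w)%E) /\
  forall t, 0 <= t -> right_filtration t [set w | (pi w <= t%:E)%E].

Definition success (T : R) (pi : Omega -> \bar R) : set Omega :=
  [set w | exists t, [/\ pi w = t%:E, t < T, record_at t w & Z t w = Z T w]].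

Definition optimal_value (T : R) : \bar R :=
  ereal_sup [set P (success T pi) | pi in [set pi | stopping_time pi]].

(* The first record time t < T with (T - t) Z_t <= s, or +oo if there is none;
   such times form a well-ordered set, so the infimum is attained. *)
Definition policy (T s : R) (w : Omega) : \bar R :=
  ereal_inf [set t%:E | t in
    [set t | [/\ record_at t w, t < T & (T - t) * Z t w <= s]]].

Definition policy_value (T s : R) : \bar R := P (success T (policy T s)).

Definition one_record_prob (s : R) : R :=
  fine (P [set w | exists! t, record_at t w /\ t < s]).

End stopping.

(* Main.v *)
Require Import Defs.
From HB Require Import structures.
From mathcomp Require Import all_boot all_order all_algebra.
From mathcomp Require Import all_classical all_reals all_analysis.
From mathcomp Require Import measurable_realfun.
From mathcomp Require Import ring lra.

Set Implicit Arguments.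
Unset Strict Implicit.
Unset Printing Implicit Defensive.

Import Order.TTheory GRing.Theory Num.Theory.
Import numFieldNormedType.Exports.

Local Open Scope classical_set_scope.
Local Open Scope ring_scope.

(* At the jump times, (T - t) R_t is the chain Y_{n+1} = (Y_n - E_n) X_n started
   at T, and the n-th jump is the last record before T iff 0 < Y_n < E_n, which
   has conditional probability exp(-Y_n).  The value of the rule that stops at
   the first Y_n <= s is KE (KX U), where KX and KE average over X and E, and U,
   the reward, is exp(-y) on (0, s] and the value itself beyond s.  For the
   beta(theta, 1) law, this fixed-point equation says that beyond s the
   derivative of the value is a multiple of exp(-y) y^(-theta), which gives the
   incomplete gamma function.

   For optimality, at the root s the reward dominates both exp(-y) and the
   value, so that for any sequence of stopping events D_n measurable with respect
   to the first n jumps, the one-step identity telescopes to an upper bound by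
   the value at T.  A stopping time pi of the natural filtration is of this form:
   up to the jump following the n-th one, the events of the filtration depend
   only on the first n jumps, hence so does {pi = n-th jump time}. *)

(** * Integration lemmas *)

(** The shape of the value beyond [s] comes from a differential equation. Let V be the value and U
    the reward. The density formulas for [KE] and [KX] turn V = KE (KX U) into V' = KX U - V and
    (y^theta KX U)' = theta y^(theta - 1) U. Beyond [s], where U = V, the function W = V' satisfies
    W' = -(1 + theta / y) W, hence W = c exp(-y) y^(-theta), and W(s) = KX U(s) - V(s) fixes c as
    [value_slope]. The code only verifies this solution. Two obstacles shape the rest. Records,
    successes and policies are defined path by path, while the computation concerns the chain; the
    two agree only when all factors lie in (0, 1) and all clocks are positive, so events are
    compared on these [good] paths and [good_ae] transfers the probabilities. Moreover, stopping
    times refer to the filtration of the process in continuous time, not to the factors and clocks: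
    both the adaptedness of the policy and the reduction of a stopping time to events of the chain
    go through countably many rational times. *)

Section density.
Import HBNNSimple.
Local Open Scope ereal_scope.
Context d (T : measurableType d) (R : realType).
Variables (mu nu : {measure set T -> \bar R}) (p : T -> R).
Hypotheses (mp : measurable_fun setT p) (p0 : forall x, (0 <= p x)%R).
Hypothesis nuE : forall A, measurable A -> nu A = \int[mu]_(x in A) (p x)%:E.

(** The hypothesis describes [nu] on sets only. Linearity extends it to simple functions, and
    monotone convergence along [nnsfun_approx] to [f]. *)
Lemma ge0_integral_density (f : T -> \bar R) : measurable_fun setT f ->
  (forall x, 0 <= f x) -> \int[nu]_x f x = \int[mu]_x (f x * (p x)%:E).
Proof.
move=> mf f0; pose f_ := nnsfun_approx measurableT mf.
have mfp n : measurable_fun setT (fun x => (f_ n x)%:E * (p x)%:E).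
  by apply/measurable_EFinP/measurable_funM => //; exact/measurable_funP.
transitivity (limn (fun n => \int[nu]_x (f_ n x)%:E)).
  rewrite -monotone_convergence//.
  - by apply: eq_integral => y _; apply/esym/cvg_lim => //; apply: cvg_nnsfun_approx => // x _; exact: f0.
  - by move=> n; exact/measurable_EFinP/measurable_funP.
  - by move=> n y _; rewrite lee_fin.
  - by move=> y _ m n mn; rewrite lee_fin; exact/lefP/nd_nnsfun_approx.
transitivity (limn (fun n => \int[mu]_x ((f_ n x)%:E * (p x)%:E))); last first.
  rewrite -monotone_convergence//.
  - apply: eq_integral => y _; apply/cvg_lim => //.
    apply: cvgeZr => //; apply: cvg_nnsfun_approx => // x _; exact: f0.
  - by move=> n y _; rewrite mule_ge0// lee_fin.
  - move=> y _ m n mn; rewrite lee_wpmul2r ?lee_fin//.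
    by exact/lefP/nd_nnsfun_approx.
congr (limn _); apply/funext => n.
under eq_integral do rewrite fimfunE -fsumEFin//.
transitivity (\int[mu]_x \sum_(r \in range (f_ n))
    ((r * \1_(f_ n @^-1` [set r]) x)%:E * (p x)%:E)); last first.
  apply: eq_integral => x _; rewrite [in RHS]fimfunE -fsumEFin// ge0_mule_fsuml// => r.
  exact: nnfun_muleindic_ge0.
rewrite !ge0_integral_fsum//.
- apply: eq_fsbigr => r _.
  have mr : measurable (f_ n @^-1` [set r]) by [].
  rewrite (integralZl_indic _ (fun r => f_ n @^-1` [set r]))//; last first.
    by move=> r0; rewrite preimage_nnfun0.
  rewrite integral_indic// setIT nuE//.
  under [RHS]eq_integral do rewrite EFinM -muleA.
  have [r0|r0] := leP 0%R r.
    rewrite ge0_integralZl//.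
    + congr (_ * _); rewrite [LHS]integral_mkcond; apply: eq_integral => x _.
      by rewrite patchE indicE; case: ifPn => _; rewrite ?mul1e ?mul0e.
    + by apply: emeasurable_funM; exact/measurable_EFinP.
    + by move=> x _; rewrite mule_ge0 ?lee_fin.
  rewrite preimage_nnfun0// integral_set0 mule0 integral0_eq// => x _.
  by rewrite indicE in_set0 mul0e mule0.
- move=> r; apply: emeasurable_funM; last exact/measurable_EFinP.
  by apply/measurable_EFinP/measurable_funM => //; exact: measurable_indic.
- by move=> r x _; rewrite mule_ge0 ?nnfun_muleindic_ge0 ?lee_fin.
- by move=> r; apply/measurable_EFinP/measurable_funM => //; exact: measurable_indic.
- by move=> r x _; rewrite nnfun_muleindic_ge0.
Qed.

End density.

(* [R] and [measurableTypeR R] carry distinct measurable structures, hence the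
   transport along the identity. *)
Section density_lebesgue.
Local Open Scope ereal_scope.
Context (R : realType) (nu : {measure set R -> \bar R}) (p : R -> R).
Hypotheses (mp : measurable_fun setT p) (p0 : forall x, (0 <= p x)%R).
Hypothesis nuE :
  forall A, measurable A -> nu A = \int[lebesgue_measure]_(x in A) (p x)%:E.

Lemma ge0_integral_density_lebesgue (f : R -> \bar R) : measurable_fun setT f ->
  (forall x, 0 <= f x) ->
  \int[nu]_x f x = \int[lebesgue_measure]_x (f x * (p x)%:E).
Proof.
move=> mf f0; pose phi (x : R) : measurableTypeR R := x.
have mphi : measurable_fun setT phi by move=> _ B mB; rewrite setTI.
have := @ge0_integral_pushforward _ _ _ _ R phi mphi nu setT f measurableT mf (fun x _ => f0 x).
rewrite preimage_setT /= => <-.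
pose pf : {measure set (measurableTypeR R) -> \bar R} :=
  @measure_function_pushforward__canonical__measure_function_Measure _ _ _ _ _ nu _ mphi.
exact: (@ge0_integral_density _ _ _ _ pf).
Qed.

End density_lebesgue.

Section affine.
Local Open Scope ereal_scope.
Context {R : realType}.
Local Notation mu := (@lebesgue_measure R).

(** The rescaled image measure gives half-open intervals their length, so it is Lebesgue measure by
    uniqueness. *)
Lemma lebesgue_measure_affine (a b : R) (A : set R) : (0 < a)%R -> measurable A ->
  a%:E * mu ((fun x => a * x + b)%R @^-1` A) = mu A.
Proof.
move=> a0 mA; pose phi (x : measurableTypeR R) : measurableTypeR R := (a * x + b)%R.
have mphi : measurable_fun [set: measurableTypeR R] phi by exact: measurable_funD.
pose pf : {measure set (measurableTypeR R) -> \bar R} :=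
  @measure_function_pushforward__canonical__measure_function_Measure _ _ _ _ _ mu _ mphi.
apply/esym; rewrite -[RHS]/(mscale (NngNum (ltW a0)) pf A).
apply: lebesgue_measure_unique => //.
move=> _ [[u v]] _ <-; rewrite /= /mscale/= /pushforward/=.
have -> : phi @^-1` `]u, v] = `]((u - b) / a)%R, ((v - b) / a)%R]%classic.
  by apply/seteqP; split => x /=;
    rewrite /phi !in_itv/= ltr_pdivrMr// ler_pdivlMr// lerBrDr ltrBlDr [(x * a)%R]mulrC.
rewrite !lebesgue_measure_itv/= !lte_fin ltr_pM2r ?invr_gt0// ltrD2r.
case: ifPn => _; last by rewrite mule0.
by rewrite -!EFinB -EFinM; congr EFin; field; rewrite gt_eqF.
Qed.

Lemma ge0_integral_affine (a b : R) (f : R -> \bar R) : (0 < a)%R ->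
  measurable_fun setT f -> (forall x, 0 <= f x) ->
  a%:E * \int[mu]_x f (a * x + b)%R = \int[mu]_x f x.
Proof.
move=> a0 mf f0; pose phi (x : measurableTypeR R) : measurableTypeR R := (a * x + b)%R.
have mphi : measurable_fun [set: measurableTypeR R] phi by exact: measurable_funD.
have := @ge0_integral_pushforward _ _ _ _ R phi mphi mu setT f measurableT mf (fun x _ => f0 x).
rewrite preimage_setT /= => <-.
pose pf : {measure set (measurableTypeR R) -> \bar R} :=
  @measure_function_pushforward__canonical__measure_function_Measure _ _ _ _ _ mu _ mphi.
have := @ge0_integral_mscale _ _ _ pf setT measurableT (NngNum (ltW a0)) f mf (fun x _ => f0 x).
move=> /= <-; apply: eq_measure_integral => /= A mA _.
exact: lebesgue_measure_affine.
Qed.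

Lemma ge0_integral_oppr (f : R -> \bar R) :
  measurable_fun setT f -> (forall x, 0 <= f x) ->
  \int[mu]_x f (- x)%R = \int[mu]_x f x.
Proof.
move=> mf f0.
have mphi : measurable_fun [set: measurableTypeR R] (-%R : _ -> measurableTypeR R) by [].
have := @ge0_integral_pushforward _ _ _ _ R _ mphi mu setT f measurableT mf (fun x _ => f0 x).
rewrite preimage_setT /= => <-.
by apply: eq_measure_integral => /= A mA _; exact: lebesgue_measureN.
Qed.

End affine.

Section indep_integral.
Local Open Scope ereal_scope.
Context d (Omega : measurableType d) (R : realType) (P : probability Omega R).
Context d' (T : measurableType d') (W : {RV P >-> T}) (xi : {RV P >-> R}).
Hypothesis Wxi : forall B C, measurable B -> measurable C ->
  P (W @^-1` B `&` xi @^-1` C) = P (W @^-1` B) * P (xi @^-1` C).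

(** The joint law agrees with the product of the laws on rectangles, hence everywhere; Tonelli then
    integrates [xi] out. *)
Lemma indep_integral (f : T * R -> \bar R) : measurable_fun setT f ->
  (forall z, 0 <= f z) ->
  \int[P]_w f (W w, xi w) = \int[P]_w \int[distribution P xi]_e f (W w, e).
Proof.
move=> mf f0.
have mWxi : measurable_fun setT (fun w => (W w, xi w)).
  exact: measurable_fun_pair.
have := @ge0_integral_pushforward _ _ _ _ R _ mWxi P setT f measurableT mf (fun x _ => f0 x).
rewrite preimage_setT /= => <-.
rewrite (eq_measure_integral (distribution P W \x distribution P xi)); last first.
  move=> A mA _; apply/esym.
  by apply: (@product_measure_unique _ _ _ _ _ _ _
    (@measure_function_pushforward__canonical__measure_function_Measure _ _ _ _ _ P _ mWxi)).
rewrite fubini_tonelli1//.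
rewrite ge0_integral_distribution//.
- exact: measurable_fun_fubini_tonelli_F.
- by move=> y; apply: integral_ge0.
Qed.

End indep_integral.

(** * The Bellman equation *)

Section kernels.
Context {R : realType}.
Variables (theta : R) (nuX nuE : probability R R).
Hypothesis theta_gt0 : 0 < theta.
Hypothesis nuXE : forall A, measurable A -> nuX A = beta1_prob theta A.
Hypothesis nuEE : forall A, measurable A -> nuE A = exponential_prob 1 A.
Local Notation lam := (@lebesgue_measure R).

Let beta1_density (x : R) := theta * x `^ (theta - 1).

Lemma measurable_beta1_density : measurable_fun setT beta1_density.
Proof. by apply: measurable_funM => //; exact: measurable_powR. Qed.

Lemma beta1_density_ge0 x : 0 <= beta1_density x.
Proof. by rewrite mulr_ge0 ?powR_ge0// ltW. Qed.

Lemma measurable_beta1_pdf : measurable_fun setT (beta1_pdf theta).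
Proof.
apply/(measurable_restrictT _ _).1 => //.
by apply: measurable_funTS; exact: measurable_beta1_density.
Qed.

Lemma beta1_pdf_ge0 x : 0 <= beta1_pdf theta x.
Proof. by rewrite /beta1_pdf patchE; case: ifP => // _; exact: beta1_density_ge0. Qed.

Local Open Scope ereal_scope.

(** The end points are null. The open interval keeps later computations away from the singularities
    at 0 and 1. *)
Lemma integral_nuX (f : R -> \bar R) : measurable_fun setT f ->
  (forall x, 0 <= f x) ->
  \int[nuX]_x f x = \int[lam]_(x in `]0%R, 1%R[) (f x * (theta * x `^ (theta - 1))%:E).
Proof.
move=> mf f0.
rewrite (@ge0_integral_density_lebesgue _ nuX (beta1_pdf theta))//; last 2 first.
- exact: measurable_beta1_pdf.
- exact: beta1_pdf_ge0.
transitivity (\int[lam]_(x in `[0%R, 1%R]) (f x * (beta1_density x)%:E)).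
  rewrite [RHS]integral_mkcond; apply: eq_integral => x _.
  by rewrite /beta1_pdf !patchE; case: ifP => _; rewrite ?mule0.
rewrite (@integral_itv_bndoo _ _ _ _ true false)//.
apply: measurable_funTS; apply: emeasurable_funM => //.
by apply/measurable_EFinP; exact: measurable_beta1_density.
Qed.

Lemma integral_nuE (f : R -> \bar R) : measurable_fun setT f ->
  (forall x, 0 <= f x) ->
  \int[nuE]_x f x = \int[lam]_(x in `]0%R, +oo[) (f x * (expR (- x))%:E).
Proof.
move=> mf f0.
rewrite (@ge0_integral_density_lebesgue _ nuE (exponential_pdf 1))//; last 2 first.
- exact: measurable_exponential_pdf.
- by move=> x; exact: exponential_pdf_ge0.
transitivity (\int[lam]_(x in `[0%R, +oo[) (f x * (expR (- x))%:E)).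
  rewrite [RHS]integral_mkcond; apply: eq_integral => x _.
  by rewrite /exponential_pdf !patchE; case: ifP => _; rewrite ?mule0// mul1r mulN1r.
rewrite integral_itv_obnd_cbnd//.
apply: measurable_funTS; apply: emeasurable_funM => //.
by apply/measurable_EFinP; apply: measurableT_comp.
Qed.

Definition KX (U : R -> \bar R) (y : R) := \int[nuX]_x U (y * x)%R.
Definition KE (U : R -> \bar R) (y : R) := \int[nuE]_e U (y - e)%R.

Variable U : R -> \bar R.
Hypotheses (mU : measurable_fun setT U) (U0 : forall y, 0 <= U y).

Lemma KX_ge0 y : 0 <= KX U y. Proof. exact: integral_ge0. Qed.

Lemma measurable_KX : measurable_fun setT (KX U).
Proof.
apply: (@measurable_fun_fubini_tonelli_F _ _ R R R nuX (fun z : R * R => U (z.1 * z.2)%R)) => //.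
by apply: measurableT_comp => //; exact: measurable_funM.
Qed.

(** The substitution [z = y * x] moves [y] out of the argument of [U] into the prefactor and the
    upper limit, where the fundamental theorem of calculus can reach it. *)
Lemma KXE y : (0 < y)%R -> KX U y =
  (theta / y `^ theta)%:E * \int[lam]_(z in `]0%R, y[) (U z * (z `^ (theta - 1))%:E).
Proof.
move=> y0; rewrite /KX integral_nuX//; last by apply: measurableT_comp => //; exact: measurable_funM.
pose g := (fun z => U z * (z `^ (theta - 1))%:E) \_ `]0%R, y[%classic.
have mg : measurable_fun setT g.
  apply/(measurable_restrictT _ _).1 => //; apply: measurable_funTS.
  by apply: emeasurable_funM => //; apply/measurable_EFinP; exact: measurable_powR.
have g0 z : 0 <= g z.
  by rewrite /g patchE; case: ifP => // _; rewrite mule_ge0// lee_fin powR_ge0.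
rewrite [in RHS]integral_mkcond -/g -(@ge0_integral_affine _ y 0%R)//.
rewrite muleA -EFinM -ge0_integralZl//=; first 1 last.
- by apply: (measurableT_comp mg); exact: measurable_funD.
- by rewrite lee_fin mulr_ge0// ?ltW// divr_gt0 ?powR_gt0.
- rewrite integral_mkcond; apply: eq_integral => x _.
  rewrite /g !patchE addr0.
  have -> : ((y * x)%R \in `]0%R, y[%classic) = (x \in `]0%R, 1%R[%classic).
    apply/idP/idP; rewrite !inE/= !in_itv/= pmulr_rgt0// => /andP[-> xy] /=.
      by rewrite -(ltr_pM2l y0) mulr1.
    by rewrite gtr_pMr.
  case: ifPn => [|_]; last by rewrite mule0.
  rewrite inE/= in_itv/= => /andP[x0 x1].
  rewrite muleCA -EFinM; congr (_ * _%:E).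
  have -> : ((y * x) `^ (theta - 1) = y `^ theta / y * x `^ (theta - 1))%R.
    by rewrite powRM ?ltW// powRB ?(gt_eqF y0) ?implybT// powRr1// ltW.
  have : (y `^ theta != 0)%R by rewrite gt_eqF// powR_gt0.
  by move=> yt; field; rewrite yt gt_eqF.
Qed.

Hypothesis U_le0 : forall y, (y <= 0)%R -> U y = 0.

Lemma KX_le0 y : (y <= 0)%R -> KX U y = 0.
Proof.
move=> y0; rewrite /KX integral_nuX//; last by apply: measurableT_comp => //; exact: measurable_funM.
apply: integral0_eq => x/=; rewrite in_itv/= => /andP[x0 x1].
by rewrite U_le0 ?mul0e// mulr_le0_ge0// ltW.
Qed.

Lemma KE_le0 y : (y <= 0)%R -> KE U y = 0.
Proof.
move=> y0; rewrite /KE integral_nuE//; last by apply: measurableT_comp => //; exact: measurable_funB.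
apply: integral0_eq => x/=; rewrite in_itv/= andbT => x0.
by rewrite U_le0 ?mul0e// subr_le0 (le_trans y0)// ltW.
Qed.

(** The substitution is [z = y - e]. The part [e >= y] of the half-line drops out because [U]
    vanishes there. *)
Lemma KEE y : (0 < y)%R -> KE U y =
  (expR (- y))%:E * \int[lam]_(z in `]0%R, y[) (U z * (expR z)%:E).
Proof.
move=> y0; rewrite /KE integral_nuE//; last by apply: measurableT_comp => //; exact: measurable_funB.
pose g := (fun z => U z * (expR z)%:E) \_ `]0%R, y[%classic.
have mg : measurable_fun setT g.
  apply/(measurable_restrictT _ _).1 => //; apply: measurable_funTS.
  by apply: emeasurable_funM => //; apply/measurable_EFinP; exact: measurable_expR.
have g0 z : 0 <= g z.
  by rewrite /g patchE; case: ifP => // _; rewrite mule_ge0// lee_fin expR_ge0.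
(* The substitution is carried out as a translation by [y], followed below by a reflection. *)
rewrite [in RHS]integral_mkcond -/g -(@ge0_integral_affine _ 1 y)// mul1e.
have mg1 : measurable_fun setT (fun x : R => g (1 * x + y)%R).
  by apply: (measurableT_comp mg) => //; exact: measurable_funD.
rewrite -ge0_integral_oppr//.
rewrite -ge0_integralZl//=; first 1 last.
- exact: (measurableT_comp mg1).
- rewrite integral_mkcond; apply: eq_integral => x _.
  rewrite /g !patchE mul1r (addrC (- x)%R).
  have -> : ((y - x)%R \in `]0%R, y[%classic) = (0 < x < y)%R.
    by apply/idP/idP; rewrite !inE/= !in_itv/= subr_gt0 ltrBlDr ltrDl andbC.
  have [x0|x0] := ltP 0%R x; last first.
    by rewrite memNset ?mule0//= in_itv/= ltNge x0.
  rewrite mem_set/= ?in_itv/= ?x0//; case: ltP => xy; last first.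
    by rewrite mule0 U_le0 ?mul0e// subr_le0.
  by rewrite muleCA -EFinM -expRD addrA addNr add0r.
Qed.

End kernels.

Section inc_gamma.
Context {R : realType}.
Local Notation lam := (@lebesgue_measure R).

Lemma inc_gammaE (a b c : R) : inc_gamma a b%:E c%:E =
  \int[lam]_(t in `]b, c[) (expR (- t) * t `^ (a - 1)).
Proof. by rewrite /inc_gamma; congr (Rintegral _ _ _). Qed.

Lemma inc_gammayE (a b : R) : inc_gamma a b%:E +oo =
  \int[lam]_(t in `]b, +oo[) (expR (- t) * t `^ (a - 1)).
Proof.
rewrite /inc_gamma; congr (Rintegral _ _ _).
by apply/seteqP; split => t /=; rewrite in_itv/= lte_fin ltry.
Qed.

Lemma measurable_gamma_integrand (a : R) (D : set R) :
  measurable_fun D (fun t : R => expR (- t) * t `^ (a - 1)).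
Proof.
apply: measurable_funTS; apply: measurable_funM; last exact: measurable_powR.
by apply: measurableT_comp.
Qed.

Lemma continuous_powR (a x : R) : 0 < x -> {for x, continuous (fun t : R => t `^ a)}.
Proof.
move=> x0; apply: differentiable_continuous; apply/derivable1_diffP.
by apply: (@ex_derive _ _ _ _ _ _ _ (is_derive1_powR a x0)).
Qed.

Lemma continuous_gamma_integrand (a x : R) : 0 < x ->
  {for x, continuous (fun t : R => expR (- t) * t `^ (a - 1))}.
Proof.
move=> x0; apply: cvgM; last exact: continuous_powR.
apply: (@continuous_comp _ _ _ (fun t : R => - t) expR); first exact: cvgN.
exact: continuous_expR.
Qed.

End inc_gamma.

(** * Probabilities of no record and of exactly one record *)

Section one_record.
Context {R : realType}.
Variables (theta : R) (nuX : probability R R).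
Hypothesis theta_gt0 : 0 < theta.
Hypothesis nuXE : forall A, measurable A -> nuX A = beta1_prob theta A.
Local Notation lam := (@lebesgue_measure R).
Local Notation KX := (KX nuX).

(** Cut off at [y <= 0], where the jump comes at or after the horizon and cannot win. *)
Definition no_record : R -> R := (fun y => expR (- y)) \_ `]0, +oo[.

Lemma no_recordE y : 0 < y -> no_record y = expR (- y).
Proof. by move=> y0; rewrite /no_record patchE mem_set//= in_itv/= y0. Qed.

Lemma no_record_le0 y : y <= 0 -> no_record y = 0.
Proof.
by move=> y0; rewrite /no_record patchE memNset//= in_itv/= andbT; apply/negP; rewrite -leNgt.
Qed.

Lemma no_record_ge0 y : 0 <= no_record y.
Proof.
have [y0|y0] := leP y 0; first by rewrite no_record_le0.
by rewrite no_recordE// expR_ge0.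
Qed.

Lemma no_record_le1 y : no_record y <= 1.
Proof.
have [y0|y0] := leP y 0; first by rewrite no_record_le0.
by rewrite no_recordE// -expR0 ler_expR oppr_le0 ltW.
Qed.

Lemma measurable_no_record : measurable_fun setT no_record.
Proof.
apply/(measurable_restrictT _ _).1 => //.
by apply: measurable_funTS; apply: measurableT_comp.
Qed.

(* The Laplace transform E[exp(-y X)], see [KX_no_record]. *)
Definition laplace (y : R) : R := theta / y `^ theta * inc_gamma theta 0%:E y%:E.

Local Open Scope ereal_scope.

Let mh : measurable_fun setT (EFin \o no_record).
Proof. by apply/measurable_EFinP; exact: measurable_no_record. Qed.

Let h0 y : 0 <= (EFin \o no_record) y.
Proof. by rewrite lee_fin no_record_ge0. Qed.

Lemma KX_no_record_le1 y : KX (EFin \o no_record) y <= 1.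
Proof.
rewrite -[leRHS](@probability_setT _ _ _ nuX) -[leRHS]mul1e -integral_cst//.
apply: ge0_le_integral => //.
- by apply: (measurableT_comp mh); exact: measurable_funM.
- by move=> x _; rewrite lee_fin no_record_le1.
Qed.

(** The integrand is unbounded at 0 when [theta < 1]. Finiteness is read off from probability: a
    positive multiple of this integral is the mean of a function bounded by 1. *)
Lemma integral_gamma_lower_lty y : (0 < y)%R ->
  \int[lam]_(t in `]0%R, y[) (expR (- t) * t `^ (theta - 1))%:E < +oo.
Proof.
move=> y0; rewrite ltey_eq; apply/orP; left; rewrite ge0_fin_numE; last first.
  by apply: integral_ge0 => t _; rewrite lee_fin mulr_ge0 ?expR_ge0 ?powR_ge0.
rewrite ltNge leye_eq; apply/eqP => Iy.
have := KX_no_record_le1 y.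
rewrite (KXE theta_gt0 nuXE)//.
under eq_integral => t.
  rewrite inE/= in_itv/= => /andP[t0 _].
  rewrite no_recordE// -EFinM; over.
by rewrite Iy gt0_muley// lte_fin divr_gt0// powR_gt0.
Qed.

Lemma KX_no_record y : (0 < y)%R -> KX (EFin \o no_record) y = (laplace y)%:E.
Proof.
move=> y0; rewrite (KXE theta_gt0 nuXE)//.
under eq_integral => t.
  rewrite inE/= in_itv/= => /andP[t0 _].
  rewrite no_recordE// -EFinM; over.
rewrite /laplace inc_gammaE [RHS]EFinM; congr (_ * _)%E.
rewrite /Rintegral fineK// ge0_fin_numE.
  exact: integral_gamma_lower_lty.
by apply: integral_ge0 => t _; rewrite lee_fin mulr_ge0 ?expR_ge0 ?powR_ge0.
Qed.

Lemma integrable_gamma_lower y : (0 < y)%R ->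
  lam.-integrable `]0%R, y] (EFin \o (fun t : R => expR (- t) * t `^ (theta - 1))%R).
Proof.
move=> y0; apply/integrableP; split.
  by apply/measurable_EFinP; exact: measurable_gamma_integrand.
under eq_integral do rewrite gee0_abs ?lee_fin ?mulr_ge0 ?expR_ge0 ?powR_ge0//.
rewrite (@integral_itv_bndoo _ _ _ _ false false); first exact: integral_gamma_lower_lty.
by apply/measurable_EFinP; exact: measurable_gamma_integrand.
Qed.

Local Close Scope ereal_scope.

Lemma laplace_le1 y : 0 < y -> laplace y <= 1.
Proof. by move=> y0; rewrite -lee_fin -KX_no_record// KX_no_record_le1. Qed.

Lemma laplace_ge y : 0 < y -> expR (- y) <= laplace y.
Proof.
move=> y0; rewrite -lee_fin -KX_no_record//.
have -> : (expR (- y))%:E = (\int[nuX]_x (cst (expR (- y))%:E) x)%E.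
  by rewrite integral_cst// -[LHS]mule1; congr (_ * _)%E; rewrite -(@probability_setT _ _ _ nuX).
rewrite /KX !(integral_nuX theta_gt0 nuXE)//; last 2 first.
- by apply: (measurableT_comp mh); exact: measurable_funM.
- by move=> x; rewrite lee_fin expR_ge0.
have md : measurable_fun (`]0, 1[ : set R) (fun x : R => (theta * x `^ (theta - 1))%:E).
  by apply/measurable_EFinP/measurable_funTS; exact: measurable_beta1_density.
apply: ge0_le_integral => //.
- by move=> x _; rewrite -EFinM lee_fin mulr_ge0 ?expR_ge0// mulr_ge0 ?powR_ge0// ltW.
- exact: emeasurable_funM.
- apply: emeasurable_funM => //; apply: measurable_funTS.
  by apply: (measurableT_comp mh); exact: measurable_funM.
- move=> x /=; rewrite in_itv/= => /andP[x0 x1].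
  rewrite lee_wpmul2r ?lee_fin ?mulr_ge0 ?powR_ge0 ?(ltW theta_gt0)//.
  by rewrite no_recordE ?mulr_gt0// ler_expR lerN2 ger_pMr// ltW.
Qed.

Lemma laplace_gt0 y : 0 < y -> 0 < laplace y.
Proof. by move=> y0; rewrite (lt_le_trans _ (laplace_ge y0))// expR_gt0. Qed.

Lemma continuous_laplace y : 0 < y -> {for y, continuous laplace}.
Proof.
move=> y0; apply: cvgM.
  apply: cvgM; first exact: cvg_cst.
  by apply: cvgV; [rewrite gt_eqF// powR_gt0|exact: continuous_powR].
(* The fundamental theorem of calculus needs [y] inside the domain of integrability; any upper limit
   beyond [y] would serve. *)
have y1 : y < y + 1 by rewrite ltrDl.
have y10 : 0 < y + 1 by rewrite (lt_trans y0).
have [+ _] := continuous_FTC1 (a := BRight (0:R)) y1 (integrable_gamma_lower y10)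
  y0 (@continuous_gamma_integrand _ theta _ y0).
move=> /derivable1_diffP/differentiable_continuous.
rewrite [X in {for y, continuous X} -> _](_ : _ = fun y => inc_gamma theta 0%:E y%:E)//.
apply/funext => z; rewrite inc_gammaE /Rintegral (@integral_itv_bndoo _ _ _ _ false false)//.
by apply/measurable_EFinP; exact: measurable_gamma_integrand.
Qed.

End one_record.

Section integral_is_derive.
Context {R : realType}.
Local Notation lam := (@lebesgue_measure R).

Lemma integral_is_derive (f F : R -> R) (a b : R) : a <= b ->
  (forall x, a <= x <= b -> is_derive x 1 F (f x)) ->
  (forall x, a <= x <= b -> {for x, continuous f}) ->
  (\int[lam]_(x in `[a, b]) (f x)%:E)%E = (F b - F a)%:E.
Proof.
rewrite le_eqVlt => /predU1P[<- _ _|ab dF cf].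
  by rewrite set_itv1 integral_set1 subrr.
have cF x : a <= x <= b -> {for x, continuous F}.
  by move=> /dF dFx; apply: differentiable_continuous; apply/derivable1_diffP.
rewrite (@continuous_FTC2 _ f F)//.
- apply: continuous_in_subspaceT => x; rewrite inE/= in_itv/=; exact: cf.
- split.
  + by move=> x; rewrite in_itv/= => /andP[ax xb]; apply: ex_derive; apply: dF; rewrite !ltW.
  + by apply: cvg_at_right_filter; apply: cF; rewrite lexx ltW.
  + by apply: cvg_at_left_filter; apply: cF; rewrite lexx ltW.
- move=> x; rewrite in_itv/= => /andP[ax xb]; rewrite derive1E.
  by apply: derive_val; apply: dF; rewrite !ltW.
Qed.

End integral_is_derive.

Section single_record.
Context {R : realType}.
Variables (theta : R) (nuX nuE : probability R R).
Hypothesis theta_gt0 : 0 < theta.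
Hypothesis nuXE : forall A, measurable A -> nuX A = beta1_prob theta A.
Hypothesis nuEE : forall A, measurable A -> nuE A = exponential_prob 1 A.
Local Notation lam := (@lebesgue_measure R).
Local Notation KX := (KX nuX).
Local Notation KE := (KE nuE).
Local Notation laplace := (laplace theta).

(** For [u > 0] this is the mean of exp(u (1 - X)), hence it lies between 1 and exp(u). *)
Definition exp_laplace (u : R) : R := expR u * laplace u.
Definition int_exp_laplace (y : R) : R := \int[lam]_(u in `]0, y]) exp_laplace u.
(* The paper's p_1, see [KE_laplace]. *)
Definition single_record (y : R) : R := expR (- y) * int_exp_laplace y.

Lemma exp_laplace_bounds (u : R) : 0 < u -> 1 <= exp_laplace u <= expR u.
Proof.
move=> u0; apply/andP; split.
  by rewrite -(expR0 R) -(subrr u) expRD ler_pM2l ?expR_gt0// (laplace_ge theta_gt0 nuXE).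
by rewrite ger_pMr ?expR_gt0// (laplace_le1 theta_gt0 nuXE).
Qed.

Lemma continuous_exp_laplace (u : R) : 0 < u -> {for u, continuous exp_laplace}.
Proof.
move=> u0; apply: cvgM; first exact: continuous_expR.
exact: (continuous_laplace theta_gt0 nuXE).
Qed.

Lemma measurable_exp_laplace (D : set R) : D `<=` `]0, +oo[ ->
  measurable_fun D exp_laplace.
Proof.
move=> D0; apply: (@measurable_funS _ _ _ _ (`]0, +oo[ : set R)) => //.
apply: open_continuous_measurable_fun; first exact: interval_open.
by move=> x; rewrite inE/= in_itv/= andbT; exact: continuous_exp_laplace.
Qed.

Lemma integrable_exp_laplace (y : R) : lam.-integrable `]0, y] (EFin \o exp_laplace).
Proof.
apply: measurable_bounded_integrable => //.
- by rewrite [X in (X < _)%E]lebesgue_measure_itv/=; case: ifP => _; rewrite ?ltry// -EFinB ltry.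
- by apply: measurable_exp_laplace => x /=; rewrite !in_itv/= andbT => /andP[].
exists (expR y); split => // M yM x /=; rewrite in_itv/= => /andP[x0 xy].
have /andP[e1 ex] := exp_laplace_bounds x0.
rewrite ger0_norm ?(le_trans _ e1)// (le_trans ex)// (le_trans _ (ltW yM))//.
by rewrite ler_expR.
Qed.

Lemma is_derive_int_exp_laplace (y : R) : 0 < y ->
  is_derive y 1 int_exp_laplace (exp_laplace y).
Proof.
move=> y0; have y1 : y < y + 1 by rewrite ltrDl.
have [dI dIE] := continuous_FTC1 (a := BRight (0:R)) y1 (integrable_exp_laplace (y + 1))
  y0 (continuous_exp_laplace y0).
by apply: DeriveDef; [exact: dI|rewrite -dIE derive1E].
Qed.

Lemma is_derive_single_record (y : R) : 0 < y ->
  is_derive y 1 single_record (- single_record y + laplace y).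
Proof.
move=> y0; have dI := is_derive_int_exp_laplace y0.
rewrite /single_record.
have -> : - (expR (- y) * int_exp_laplace y) + laplace y =
  expR (- y) *: exp_laplace y + int_exp_laplace y *: (- expR (- y)).
  rewrite /exp_laplace /GRing.scale/= mulrA -expRD addNr expR0 mul1r; ring.
apply: is_deriveM.
apply: is_derive_eq; rewrite /GRing.scale/=; ring.
Qed.

Lemma int_exp_laplaceE y : (\int[lam]_(u in `]0%R, y[) (exp_laplace u)%:E)%E = (int_exp_laplace y)%:E.
Proof.
rewrite /int_exp_laplace /Rintegral fineK; last first.
  by apply: integrable_fin_num => //; exact: integrable_exp_laplace.
rewrite (@integral_itv_bndoo _ _ _ _ false false)//.
apply/measurable_EFinP; apply: measurable_exp_laplace => x /=.
by rewrite !in_itv/= andbT => /andP[].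
Qed.

Lemma int_exp_laplace_bounds (y : R) : 0 < y -> y <= int_exp_laplace y <= y * expR y.
Proof.
move=> y0; rewrite -2!lee_fin -int_exp_laplaceE.
have mp : measurable_fun (`]0, y[ : set R) (EFin \o exp_laplace).
  apply/measurable_EFinP; apply: measurable_exp_laplace => x /=.
  by rewrite !in_itv/= andbT => /andP[].
have cstE c : (c%:E * y%:E = \int[lam]_(u in `]0%R, y[) (cst c%:E) u)%E.
  by rewrite integral_cst// [X in _ = (_ * X)%E]lebesgue_measure_itv/= lte_fin y0 -EFinB subr0.
apply/andP; split.
  rewrite -[leLHS]mul1e (cstE 1); apply: ge0_le_integral => // x /=.
  rewrite in_itv/= => /andP[x0 _]; rewrite lee_fin.
  by have /andP[] := exp_laplace_bounds x0.
rewrite mulrC EFinM (cstE (expR y)); apply: ge0_le_integral => // x /=;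
  rewrite in_itv/= => /andP[x0 xy]; have /andP[e1 ex] := exp_laplace_bounds x0; rewrite lee_fin.
  by rewrite (le_trans _ e1).
by rewrite (le_trans ex)// ler_expR ltW.
Qed.

(** Exactly one record before the horizon means that one step of the chain is followed by no further
    record, so this expression is the probability in question. *)
Lemma KE_laplace (y : R) : 0 < y ->
  KE (KX (EFin \o no_record)) y = (single_record y)%:E.
Proof.
move=> y0.
have mh : measurable_fun setT (EFin \o @no_record R).
  by apply/measurable_EFinP; exact: measurable_no_record.
have h0 z : (0 <= (EFin \o @no_record R) z)%E by rewrite lee_fin no_record_ge0.
rewrite (KEE nuEE)//.
- under eq_integral => z.
    rewrite inE/= in_itv/= => /andP[z0 _].
    rewrite (KX_no_record theta_gt0 nuXE)// -EFinM mulrC; over.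
  by rewrite int_exp_laplaceE -EFinM.
- exact: measurable_KX.
- by move=> z; exact: KX_ge0.
- move=> z z0; rewrite (KX_le0 theta_gt0 nuXE)// => x x0.
  by rewrite /= no_record_le0.
Qed.

Lemma single_record_gt0 (y : R) : 0 < y -> 0 < single_record y.
Proof.
move=> y0; rewrite mulr_gt0 ?expR_gt0//.
by have /andP[+ _] := int_exp_laplace_bounds y0; apply: lt_le_trans.
Qed.

Lemma single_record_le1 (y : R) : 0 < y -> single_record y <= 1.
Proof.
move=> y0; rewrite -lee_fin -KE_laplace//.
rewrite -[leRHS](@probability_setT _ _ _ nuE) -[leRHS]mul1e -integral_cst//.
apply: ge0_le_integral => //.
- by move=> x _; apply: KX_ge0 => z; rewrite lee_fin no_record_ge0.
- apply: (measurableT_comp (measurable_KX _ _ _)); last exact: measurable_funB.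
  + by apply/measurable_EFinP; exact: measurable_no_record.
  + by move=> z; rewrite lee_fin no_record_ge0.
- by move=> x _; exact: KX_no_record_le1.
Qed.

Lemma int_exp_laplace_incr x y : 0 < x -> x < y -> int_exp_laplace x < int_exp_laplace y.
Proof.
move=> x0 xy.
have d z : x <= z -> is_derive z 1 int_exp_laplace (exp_laplace z).
  by move=> xz; apply: is_derive_int_exp_laplace; exact: lt_le_trans xz.
apply: (@gtr0_derive1_incr _ _ x y) => //.
- by move=> z; rewrite in_itv/= => /andP[/ltW/d dz _]; exact: ex_derive.
- move=> z; rewrite in_itv/= => /andP[xz _]; have dz := d z (ltW xz); rewrite derive1E derive_val.
  by have /andP[+ _] := exp_laplace_bounds (lt_trans x0 xz); exact: lt_le_trans.
- apply: derivable_within_continuous => z; rewrite in_itv/= => /andP[/d dz _].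
  exact: ex_derive.
Qed.

Lemma int_exp_laplace_root : exists s, 0 < s /\ int_exp_laplace s = 1.
Proof.
(* Since [a < 1], the upper bound [a * expR a] is at most exp(-1) exp(1) = 1; at 1 the lower bound
   is already 1. So the root lies in [[a, 1]]. *)
pose a : R := expR (-1).
have a0 : 0 < a by exact: expR_gt0.
have a1 : a < 1 by rewrite -expR0 ltr_expR oppr_lt0.
have [] := @IVT _ int_exp_laplace a 1 1 (ltW a1).
- apply: derivable_within_continuous => z; rewrite in_itv/= => /andP[az _].
  exact/ex_derive/is_derive_int_exp_laplace/(lt_le_trans a0).
- apply/andP; split; last by rewrite le_max; have /andP[-> _] := int_exp_laplace_bounds (@ltr01 R); rewrite orbT.
  rewrite ge_min; apply/orP; left; have /andP[_ /le_trans->//] := int_exp_laplace_bounds a0.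
  by rewrite /a -expRD -[leRHS]expR0 ler_expR addrC subr_le0 ltW.
by move=> s; rewrite in_itv/= => /andP[as_ _] Is; exists s; rewrite (lt_le_trans a0).
Qed.

End single_record.

Lemma measurable_invr {R : realType} : measurable_fun setT (fun x : R => x^-1).
Proof.
(* Inversion is not continuous at 0; this product of measurable functions also has the right sign
   for [x < 0] and the default value 0 at 0. *)
rewrite (_ : (fun x : R => x^-1) = (fun x => x * (x ^+ 2) `^ (-1))).
  apply: measurable_funM => //.
  exact: (measurableT_comp (measurable_powR (-1))).
apply/funext => x; rewrite powR_inv1 ?sqr_ge0//.
have [->|x0] := eqVneq x 0; first by rewrite mul0r invr0.
by rewrite expr2 invfM mulrA divff// mul1r.
Qed.

Section single_record_integral.
Context {R : realType}.
Variables (theta : R) (nuX nuE : probability R R).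
Hypothesis theta_gt0 : 0 < theta.
Hypothesis nuXE : forall A, measurable A -> nuX A = beta1_prob theta A.
Hypothesis nuEE : forall A, measurable A -> nuE A = exponential_prob 1 A.
Local Notation lam := (@lebesgue_measure R).
Local Notation single_record := (single_record theta).
Local Notation int_exp_laplace := (int_exp_laplace theta).

Let ratio (y x : R) := (expR (- (y * x)) - expR (- y)) / (1 - x).

(** Numerator and denominator change sign together at [x = 1]. All real [x] are covered because
    [integral_nuX] asks for functions nonnegative on the whole line. *)
Lemma ratio_ge0 (y x : R) : 0 < y -> 0 <= ratio y x.
Proof.
move=> y0; rewrite /ratio; have [x1|x1] := leP x 1.
  rewrite divr_ge0 ?subr_ge0// ler_expR lerN2 ger_pMr//.
rewrite -[leRHS]mulrNN -invrN !opprB mulr_ge0 ?invr_ge0 ?subr_ge0 ?(ltW x1)//.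
by rewrite ler_expR lerN2 ler_pMr// ltW.
Qed.

Lemma measurable_ratio (y : R) : measurable_fun setT (ratio y).
Proof.
apply: measurable_funM.
  apply: measurable_funB => //; apply: measurableT_comp => //.
  by apply: measurableT_comp => //; exact: measurable_funM.
by apply: (measurableT_comp measurable_invr); exact: measurable_funB.
Qed.

(** With the factor frozen at [x], the average over the clock is an elementary exponential
    integral. *)
Lemma KE_no_record_scaled (y x : R) : 0 < y -> 0 < x < 1 ->
  KE nuE (fun z => (no_record (z * x))%:E) y = (ratio y x)%:E.
Proof.
move=> y0 /andP[x0 x1]; have x1' : 0 < 1 - x by rewrite subr_gt0.
rewrite (KEE nuEE)//; last 3 first.
- apply/measurable_EFinP; apply: measurableT_comp; first exact: measurable_no_record.
  exact: measurable_funM.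
- by move=> z; rewrite lee_fin no_record_ge0.
- by move=> z z0; rewrite no_record_le0// mulr_le0_ge0// ltW.
pose f z := expR ((1 - x) * z).
have -> : (\int[lam]_(z in `]0%R, y[) ((no_record (z * x))%:E * (expR z)%:E))%E =
    (\int[lam]_(z in `[0%R, y]) (f z)%:E)%E.
  rewrite [RHS](@integral_itv_bndoo _ _ _ _ true false); last first.
    apply/measurable_EFinP; apply: measurable_funTS.
    by apply: (measurableT_comp (@measurable_expR R)); exact: measurable_funM.
  apply: eq_integral => z; rewrite inE/= in_itv/= => /andP[z0 _].
  by rewrite no_recordE ?mulr_gt0// -EFinM -expRD; congr (expR _)%:E; ring.
have df z : 0 <= z <= y -> is_derive z 1 (fun z => f z / (1 - x)) (f z).
  move=> _; rewrite /f; apply: is_derive_eq.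
  by rewrite /GRing.scale/=; field; rewrite gt_eqF.
have cf z : 0 <= z <= y -> {for z, continuous f}.
  move=> _; apply: (@continuous_comp _ _ _ (fun z => (1 - x) * z) expR).
    by apply: cvgM; [exact: cvg_cst|exact: cvg_id].
  exact: continuous_expR.
rewrite (integral_is_derive (ltW y0) df cf).
rewrite -EFinM; congr EFin; rewrite /f /ratio mulr0 expR0.
rewrite mulrBr !mulrA -expRD mulr1 -mulrBl; congr ((expR _ - _) / _); ring.
Qed.

(** Tonelli: [KE_laplace] averages over the factor first, the integral formula for p_1 over the
    clock first. *)
Lemma integral_ratio (y : R) : 0 < y ->
  (\int[nuX]_x (ratio y x)%:E)%E = (single_record y)%:E.
Proof.
move=> y0; rewrite -(KE_laplace theta_gt0 nuXE nuEE)//.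
pose k (z : R * R) : \bar R := (no_record ((y - z.2) * z.1))%:E.
have mk : measurable_fun setT k.
  apply/measurable_EFinP; apply: measurableT_comp; first exact: measurable_no_record.
  by apply: measurable_funM => //; exact: measurable_funB.
have k0 z : (0 <= k z)%E by rewrite lee_fin no_record_ge0.
rewrite [RHS](_ : _ = (\int[nuX]_x \int[nuE]_e k (x, e))%E); last first.
  by rewrite fubini_tonelli.
rewrite !(integral_nuX theta_gt0 nuXE)//.
- apply: eq_integral => x; rewrite inE/= in_itv/= => x01.
  by rewrite -(KE_no_record_scaled y0 x01).
- exact: (measurable_fun_fubini_tonelli_F (m2 := nuE) _ mk k0).
- by move=> x; exact: integral_ge0.
- by apply/measurable_EFinP; exact: measurable_ratio.
- by move=> x; rewrite lee_fin ratio_ge0.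
Qed.

Lemma single_recordE (y : R) : 0 < y -> single_record y =
  \int[lam]_(x in `[0, 1]) (ratio y x * (theta * x `^ (theta - 1))).
Proof.
move=> y0; rewrite /Rintegral (@integral_itv_bndoo _ _ _ _ true false); last first.
  apply/measurable_EFinP/measurable_funTS; apply: measurable_funM.
    exact: measurable_ratio.
  exact: measurable_beta1_density.
under eq_integral do rewrite EFinM.
rewrite -(integral_nuX theta_gt0 nuXE (f := fun x => (ratio y x)%:E)).
- by rewrite integral_ratio.
- by apply/measurable_EFinP; exact: measurable_ratio.
- by move=> x; rewrite lee_fin ratio_ge0.
Qed.

(** The left-hand side is the expectation in the equation for s_*, and it is exp(y) times
    [single_record y]. The equation thus says that exactly one further record is as likely as
    none. *)
Lemma integral_exp_ratio (y : R) : 0 < y ->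
  (\int[nuX]_x ((expR (y * (1 - x)) - 1) / (1 - x))%:E)%E = (int_exp_laplace y)%:E.
Proof.
move=> y0; have -> : int_exp_laplace y = expR y * single_record y.
  by rewrite /single_record mulrA -expRD subrr expR0 mul1r.
rewrite EFinM -integral_ratio// -ge0_integralZl//.
- apply: eq_integral => x _; rewrite -EFinM /ratio; congr EFin.
  by rewrite [RHS]mulrA [in RHS]mulrBr -![in RHS]expRD subrr expR0 mulrBr mulr1.
- by apply/measurable_EFinP; exact: measurable_ratio.
- by move=> x _; rewrite lee_fin ratio_ge0.
Qed.

End single_record_integral.

(** * The value function and its fixed-point equation *)

Section value.
Context {R : realType}.
Variables (theta : R) (nuX nuE : probability R R).
Hypothesis theta_gt0 : 0 < theta.
Hypothesis nuXE : forall A, measurable A -> nuX A = beta1_prob theta A.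
Hypothesis nuEE : forall A, measurable A -> nuE A = exponential_prob 1 A.
Local Notation lam := (@lebesgue_measure R).
Local Notation laplace := (laplace theta).
Local Notation int_exp_laplace := (int_exp_laplace theta).
Local Notation single_record := (single_record theta).
Variable s : R.
Hypothesis s_gt0 : 0 < s.

Let gamma_density (t : R) := expR (- t) * t `^ (- theta + 1 - 1).
(** Only differences of its values occur. Starting at [s / 2] makes it differentiable at [s] too. *)
Let upper_gamma (y : R) := \int[lam]_(t in `]s / 2, y]) gamma_density t.

(** Normalised so that [late_value] continues [single_record] beyond [s] with the same value and the
    same derivative [laplace s - single_record s]. *)
Definition value_slope : R := expR s * s `^ theta * (laplace s - single_record s).
Definition late_value (y : R) : R :=
  inc_gamma (- theta + 1) s%:E y%:E * value_slope + single_record s.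

Let s2_gt0 : 0 < s / 2. Proof. by rewrite divr_gt0. Qed.
Let s2_lt : s / 2 < s. Proof. by rewrite gtr_pMr// invf_lt1// ltr1n. Qed.

Let powRtheta (t : R) : t `^ (- theta + 1 - 1) = (t `^ theta)^-1.
Proof. by rewrite addrK powRN. Qed.

Let integrable_gamma_density (y : R) :
  lam.-integrable `]s / 2, y] (EFin \o gamma_density).
Proof.
apply: (@integrableS _ _ _ _ (`[s / 2, y] : set (measurableTypeR R))) => //.
  by move=> x /=; rewrite !in_itv/= => /andP[/ltW-> ->].
apply: continuous_compact_integrable; first exact: segment_compact.
apply: continuous_in_subspaceT => x; rewrite inE/= in_itv/= => /andP[sx _].
by apply: continuous_gamma_integrand; rewrite (lt_le_trans s2_gt0).
Qed.

Let is_derive_upper_gamma (y : R) : s / 2 < y ->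
  is_derive y 1 upper_gamma (gamma_density y).
Proof.
move=> y0; have y1 : y < y + 1 by rewrite ltrDl.
have [dI dIE] := continuous_FTC1 (a := BRight (s / 2)) y1 (integrable_gamma_density (y + 1))
  y0 (@continuous_gamma_integrand _ (- theta + 1) _ (lt_trans s2_gt0 y0)).
by apply: DeriveDef; [exact: dI|rewrite -dIE derive1E].
Qed.

Let inc_gamma_upper (y : R) : s <= y ->
  inc_gamma (- theta + 1) s%:E y%:E = upper_gamma y - upper_gamma s.
Proof.
move=> sy; rewrite /upper_gamma Rintegral_itvB ?bnd_simp//; last exact: ltW.
rewrite inc_gammaE /Rintegral; congr fine.
rewrite (@integral_itv_bndoo _ _ _ _ false false)//.
by apply/measurable_EFinP; exact: measurable_gamma_integrand.
Qed.

(** Extends [late_value] to the left of [s], so that two-sided derivatives exist at both ends of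
    [[s, y]], as [integral_is_derive] requires. *)
Let smooth_value (y : R) : R := (upper_gamma y - upper_gamma s) * value_slope + single_record s.

Let is_derive_smooth_value (y : R) : s / 2 < y ->
  is_derive y 1 smooth_value (value_slope * gamma_density y).
Proof.
move=> y0; have d := is_derive_upper_gamma y0; rewrite /smooth_value.
apply: is_derive_eq; rewrite /GRing.scale/=; ring.
Qed.

Lemma inc_gamma_refl : inc_gamma (- theta + 1) s%:E s%:E = 0.
Proof. by rewrite inc_gamma_upper// subrr. Qed.

Lemma late_value_start : late_value s = single_record s.
Proof. by rewrite /late_value inc_gamma_refl mul0r add0r. Qed.

Let late_valueE (y : R) : s <= y -> late_value y = smooth_value y.
Proof. by move=> sy; rewrite /late_value inc_gamma_upper. Qed.

Lemma gamma_density_le (t : R) : s <= t -> gamma_density t <= (s `^ theta)^-1 * expR (- t).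
Proof.
move=> st; rewrite /gamma_density powRtheta mulrC ler_wpM2r ?expR_ge0//.
rewrite lef_pV2 ?posrE ?powR_gt0//; last exact: lt_le_trans st.
by apply: ge0_ler_powR => //; rewrite ?nnegrE ?ltW// (lt_le_trans s_gt0).
Qed.

(** Bounding t^(-theta) by s^(-theta) leaves the integral of exp(-t). The resulting constant is
    exactly the one that keeps the weight in [late_value_convex] at most 1. *)
Lemma inc_gamma_upper_bounds (y : R) : s <= y ->
  0 <= inc_gamma (- theta + 1) s%:E y%:E <= (s `^ theta)^-1 * expR (- s).
Proof.
move=> sy; have g0 t : 0 <= gamma_density t by rewrite mulr_ge0 ?expR_ge0 ?powR_ge0.
rewrite inc_gammaE; apply/andP; split; first by apply: Rintegral_ge0 => t _; exact: g0.
have df z : s <= z <= y -> is_derive z 1 (fun z => - ((s `^ theta)^-1 * expR (- z)))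
    ((s `^ theta)^-1 * expR (- z)).
  by move=> _; apply: is_derive_eq; rewrite /GRing.scale/=; ring.
have cf z : s <= z <= y -> {for z, continuous (fun z => (s `^ theta)^-1 * expR (- z))}.
  move=> _; apply: cvgM; first exact: cvg_cst.
  apply: (@continuous_comp _ _ _ (fun z : R => - z) expR); first exact: cvgN.
  exact: continuous_expR.
have mg : measurable_fun (`]s, y[ : set R) (fun t => (gamma_density t)%:E).
  by apply/measurable_EFinP; exact: measurable_gamma_integrand.
have := integral_is_derive sy df cf; rewrite (@integral_itv_bndoo _ _ _ _ true false); last first.
  apply/measurable_EFinP/measurable_funTS/measurable_funM => //.
  exact: measurableT_comp.
move=> E; rewrite -lee_fin /Rintegral fineK; last first.
  apply: integrable_fin_num => //; apply: integrableS (integrable_gamma_density y) => //.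
  by move=> x /=; rewrite !in_itv/= => /andP[sx /ltW->]; rewrite (lt_trans s2_lt).
apply: (@le_trans _ _ (- ((s `^ theta)^-1 * expR (- y)) - - ((s `^ theta)^-1 * expR (- s)))%:E).
  rewrite -E; apply: ge0_le_integral => //.
  - by move=> t _; exact: g0.
  - apply/measurable_EFinP/measurable_funTS/measurable_funM => //.
    exact: measurableT_comp.
  - by move=> t /=; rewrite in_itv/= => /andP[/ltW st _]; rewrite lee_fin gamma_density_le.
by rewrite lee_fin opprK gerDr oppr_le0 mulr_ge0 ?expR_ge0// invr_ge0 powR_ge0.
Qed.

(* [late_value y] is a convex combination of [single_record s] and [laplace s]. *)
Lemma late_value_convex (y : R) : s <= y -> exists2 l : R, 0 <= l <= 1 &
  late_value y = (1 - l) * single_record s + l * laplace s.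
Proof.
move=> sy; have /andP[g0 g1] := inc_gamma_upper_bounds sy.
have st : 0 < s `^ theta by exact: powR_gt0.
exists (inc_gamma (- theta + 1) s%:E y%:E * (expR s * s `^ theta)).
  rewrite mulr_ge0 ?mulr_ge0 ?expR_ge0 ?(ltW st)//=.
  rewrite -ler_pdivlMr ?mulr_gt0 ?expR_gt0// (le_trans g1)//.
  by rewrite div1r invfM mulrC expRN.
rewrite /late_value /value_slope; ring.
Qed.

Lemma late_value_bounds (y : R) : s <= y -> 0 <= late_value y <= 1.
Proof.
move=> /late_value_convex[l /andP[l0 l1] ->].
have p0 := single_record_gt0 theta_gt0 nuXE s_gt0.
have p1 := single_record_le1 theta_gt0 nuXE nuEE s_gt0.
have q0 := laplace_gt0 theta_gt0 nuXE s_gt0.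
have q1 := laplace_le1 theta_gt0 nuXE s_gt0.
apply/andP; split; first by rewrite addr_ge0// mulr_ge0// ?subr_ge0// ltW.
nra.
Qed.

(** The common shape of [value] and [reward], which differ only on [(0, s]]. The point [s] belongs
    to the early side because the policy stops at equality. *)
Definition early_late (f : R -> R) (y : R) : R :=
  (f \_ `]0, s]) y + (late_value \_ `]s, +oo[) y.
Definition value := early_late single_record.
Definition reward := early_late (fun y => expR (- y)).

Lemma early_late_le0 f (y : R) : y <= 0 -> early_late f y = 0.
Proof.
move=> y0; rewrite /early_late !patchE !memNset/= ?addr0//; rewrite in_itv/= ?andbT.
  by apply/negP; rewrite -leNgt (le_trans y0)// ltW.
by apply/negP; rewrite ltNge y0.
Qed.

Lemma early_lateL f (y : R) : 0 < y <= s -> early_late f y = f y.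
Proof.
move=> /andP[y0 ys]; rewrite /early_late !patchE mem_set/= ?in_itv/= ?y0// memNset ?addr0//=.
by rewrite in_itv/= andbT; apply/negP; rewrite -leNgt.
Qed.

Lemma early_lateR f (y : R) : s < y -> early_late f y = late_value y.
Proof.
move=> ys; rewrite /early_late !patchE memNset/= ?add0r; last first.
  by rewrite in_itv/= leNgt ys andbF.
by rewrite mem_set//= in_itv/= ys.
Qed.

Lemma early_late_bounds f : (forall y, 0 < y <= s -> 0 <= f y <= 1) ->
  forall y, 0 <= early_late f y <= 1.
Proof.
move=> f01 y; have [y0|y0] := leP y 0; first by rewrite early_late_le0// lexx ler01.
have [ys|ys] := leP y s; first by rewrite early_lateL ?y0//; apply: f01; rewrite y0.
by rewrite early_lateR//; apply: late_value_bounds; rewrite ltW.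
Qed.

Lemma value_bounds y : 0 <= value y <= 1.
Proof.
apply: early_late_bounds => z /andP[z0 _].
by rewrite (ltW (single_record_gt0 theta_gt0 nuXE z0)) (single_record_le1 theta_gt0 nuXE nuEE z0).
Qed.

Lemma reward_bounds y : 0 <= reward y <= 1.
Proof.
apply: early_late_bounds => z /andP[z0 _].
by rewrite expR_ge0 -expR0 ler_expR oppr_le0 ltW.
Qed.

Lemma measurable_early_late f : measurable_fun (`]0, s] : set R) f ->
  measurable_fun setT (early_late f).
Proof.
move=> mf; apply: measurable_funD; apply/(measurable_restrictT _ _).1 => //.
apply: (@eq_measurable_fun _ _ _ _ _ smooth_value).
  by move=> y; rewrite inE/= in_itv/= andbT => /ltW sy; rewrite late_valueE.
apply: open_continuous_measurable_fun; first exact: interval_open.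
move=> y; rewrite inE/= in_itv/= andbT => sy.
have d := is_derive_smooth_value (lt_trans s2_lt sy).
exact/differentiable_continuous/derivable1_diffP.
Qed.

Lemma measurable_value : measurable_fun setT value.
Proof.
apply: measurable_early_late; apply: (@measurable_funS _ _ _ _ (`]0, +oo[ : set R)) => //.
  by move=> x /=; rewrite !in_itv/= andbT => /andP[].
apply: open_continuous_measurable_fun; first exact: interval_open.
move=> y; rewrite inE/= in_itv/= andbT => y0.
have d := is_derive_single_record theta_gt0 nuXE y0.
exact/differentiable_continuous/derivable1_diffP.
Qed.

Lemma measurable_reward : measurable_fun setT reward.
Proof.
by apply: measurable_early_late; apply: measurable_funTS; exact: measurableT_comp.
Qed.

Let mreward : measurable_fun setT (EFin \o reward).
Proof. by apply/measurable_EFinP; exact: measurable_reward. Qed.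

Let reward0 y : (0 <= (EFin \o reward) y)%E.
Proof. by rewrite lee_fin; have /andP[] := reward_bounds y. Qed.

Lemma KX_reward_early (y : R) : 0 < y <= s ->
  KX nuX (EFin \o reward) y = (laplace y)%:E.
Proof.
move=> /andP[y0 ys]; rewrite -(KX_no_record theta_gt0 nuXE)//.
rewrite !(KXE theta_gt0 nuXE)//.
- congr (_ * _)%E; apply: eq_integral => z; rewrite inE/= in_itv/= => /andP[z0 zy].
  by rewrite /= /reward early_lateL ?no_recordE// z0 (le_trans (ltW zy)).
- by apply/measurable_EFinP; exact: measurable_no_record.
- by move=> z; rewrite lee_fin no_record_ge0.
Qed.

(** In terms of the value V beyond [s], this is KX U = V + V', the differentiated form of V = KE (KX
    U). *)
Lemma KX_reward_late (y : R) : s < y ->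
  KX nuX (EFin \o reward) y = (late_value y + value_slope * gamma_density y)%:E.
Proof.
move=> sy; have y0 : 0 < y by exact: lt_trans sy.
rewrite (KXE theta_gt0 nuXE)//.
have -> : `]0, y[%classic = `]0, s]%classic `|` `]s, y[%classic :> set R.
  apply/seteqP; split => z /=; rewrite !in_itv/=.
    by move=> /andP[z0 zy]; have [zs|zs] := leP z s; [left|right]; rewrite ?z0 ?zs.
  by case=> /andP[z0 zy]; rewrite ?z0 ?zy ?(le_lt_trans zy)// (lt_trans _ z0).
have mU : measurable_fun setT (fun z : R => ((EFin \o reward) z * (z `^ (theta - 1))%:E)%E).
  by apply: emeasurable_funM => //; apply/measurable_EFinP; exact: measurable_powR.
rewrite ge0_integral_setU//; last 3 first.
- exact: measurable_funTS.
- by move=> z _; rewrite mule_ge0// lee_fin powR_ge0.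
- apply/disj_setPS => z [] /=; rewrite !in_itv/= => /andP[_ zs] /andP[+ _].
  by rewrite ltNge zs.
have -> : (\int[lam]_(z in `]0%R, s]) ((EFin \o reward) z * (z `^ (theta - 1))%:E))%E =
    (inc_gamma theta 0%:E s%:E)%:E.
  rewrite (@integral_itv_bndoo _ _ _ _ false false); last exact: measurable_funTS.
  rewrite inc_gammaE /Rintegral fineK; last first.
    rewrite ge0_fin_numE; first exact: (integral_gamma_lower_lty theta_gt0 nuXE).
    by apply: integral_ge0 => t _; rewrite lee_fin mulr_ge0 ?expR_ge0 ?powR_ge0.
  apply: eq_integral => z; rewrite inE/= in_itv/= => /andP[z0 zs].
  by rewrite /= /reward early_lateL ?z0 ?ltW// EFinM.
(* Integration by parts: z^theta times the derivative of [smooth_value] is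
   [value_slope * expR (- z)], which has an explicit antiderivative. *)
pose F z := (z `^ theta * smooth_value z + value_slope * expR (- z)) / theta.
have df z : s <= z <= y -> is_derive z 1 F (smooth_value z * z `^ (theta - 1)).
  move=> /andP[sz _]; have z0 := lt_le_trans s_gt0 sz.
  have d1 := is_derive_smooth_value (lt_le_trans s2_lt sz).
  have d2 := is_derive1_powR theta z0.
  rewrite /F; apply: is_derive_eq.
  rewrite /GRing.scale/= /gamma_density powRtheta.
  have zt : z `^ theta != 0 by rewrite gt_eqF// powR_gt0.
  by field; rewrite zt gt_eqF.
have cf z : s <= z <= y -> {for z, continuous (fun z => smooth_value z * z `^ (theta - 1))}.
  move=> /andP[sz _]; apply: cvgM; last by apply: continuous_powR; exact: lt_le_trans sz.
  have d := is_derive_smooth_value (lt_le_trans s2_lt sz).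
  exact/differentiable_continuous/derivable1_diffP.
have -> : (\int[lam]_(z in `]s, y[) ((EFin \o reward) z * (z `^ (theta - 1))%:E))%E =
    (F y - F s)%:E.
  rewrite -(integral_is_derive (ltW sy) df cf) [RHS](@integral_itv_bndoo _ _ _ _ true false).
    apply: eq_integral => z; rewrite inE/= in_itv/= => /andP[sz zy].
    by rewrite /= /reward early_lateR// late_valueE ?(ltW sz)// EFinM.
  apply: eq_measurable_fun (measurable_funTS mU) => z.
  rewrite inE/= in_itv/= => /andP[sz zy].
  by rewrite /= /reward early_lateR// late_valueE ?(ltW sz)// EFinM.
rewrite -EFinD -EFinM; congr EFin.
rewrite late_valueE ?ltW// /F /gamma_density powRtheta.
have -> : smooth_value s = single_record s by rewrite -late_valueE// late_value_start.
have yt : y `^ theta != 0 by rewrite gt_eqF// powR_gt0.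
have st : s `^ theta != 0 by rewrite gt_eqF// powR_gt0.
have -> : inc_gamma theta 0%:E s%:E = laplace s * s `^ theta / theta.
  by rewrite /laplace; field; rewrite st gt_eqF.
(* With this slope, [F s] equals the integral over [(0, s]], so the two cancel and only [F y]
   remains. *)
have -> : value_slope * expR (- s) = s `^ theta * (laplace s - single_record s).
  by rewrite /value_slope expRN; field; rewrite gt_eqF// expR_gt0.
by field; rewrite yt gt_eqF.
Qed.

(** Up to [s] the chain sees only the part of the reward that is [no_record], and the claim is
    [KE_laplace]. Beyond [s] the integrand is the derivative of exp(z) V(z), whose boundary term at
    [s] cancels the integral over [(0, s]]. *)
Lemma KE_KX_reward (y : R) : KE nuE (KX nuX (EFin \o reward)) y = (value y)%:E.
Proof.
have mK : measurable_fun setT (KX nuX (EFin \o reward)) by exact: measurable_KX.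
have K0 z : (0 <= KX nuX (EFin \o reward) z)%E by exact: KX_ge0.
have Kle z : z <= 0 -> KX nuX (EFin \o reward) z = 0%E.
  by move=> z0; apply: (KX_le0 theta_gt0 nuXE) => // x x0; rewrite /= /reward early_late_le0.
have [y0|y0] := leP y 0; first by rewrite (KE_le0 nuEE)// /value early_late_le0.
have [ys|sy] := leP y s.
  rewrite (KEE nuEE mK K0 Kle y0) /value early_lateL ?y0// -(KE_laplace theta_gt0 nuXE nuEE)//.
  have mh : measurable_fun setT (EFin \o @no_record R).
    by apply/measurable_EFinP; exact: measurable_no_record.
  have h0 z : (0 <= (EFin \o @no_record R) z)%E by rewrite lee_fin no_record_ge0.
  have mKh : measurable_fun setT (KX nuX (EFin \o @no_record R)) by exact: measurable_KX.
  have Kh0 z : (0 <= KX nuX (EFin \o @no_record R) z)%E by exact: KX_ge0.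
  have Khle z : z <= 0 -> KX nuX (EFin \o @no_record R) z = 0%E.
    by move=> z0; apply: (KX_le0 theta_gt0 nuXE) => // x x0; rewrite /= no_record_le0.
  rewrite (KEE nuEE mKh Kh0 Khle y0).
  congr (_ * _)%E; apply: eq_integral => z; rewrite inE/= in_itv/= => /andP[z0 zy].
  by rewrite KX_reward_early ?(KX_no_record theta_gt0 nuXE)// z0 (le_trans (ltW zy)).
rewrite (KEE nuEE mK K0 Kle y0) /value early_lateR//.
have -> : `]0, y[%classic = `]0, s]%classic `|` `]s, y[%classic :> set R.
  apply/seteqP; split => z /=; rewrite !in_itv/=.
    by move=> /andP[z0 zy]; have [zs|zs] := leP z s; [left|right]; rewrite ?z0 ?zs.
  by case=> /andP[z0 zy]; rewrite ?z0 ?zy ?(le_lt_trans zy)// (lt_trans _ z0).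
have mU : measurable_fun setT (fun z : R => (KX nuX (EFin \o reward) z * (expR z)%:E)%E).
  by apply: emeasurable_funM => //; apply/measurable_EFinP; exact: measurable_expR.
rewrite ge0_integral_setU//; last 3 first.
- exact: measurable_funTS.
- by move=> z _; rewrite mule_ge0// lee_fin expR_ge0.
- apply/disj_setPS => z [] /=; rewrite !in_itv/= => /andP[_ zs] /andP[+ _].
  by rewrite ltNge zs.
have -> : (\int[lam]_(z in `]0%R, s]) (KX nuX (EFin \o reward) z * (expR z)%:E))%E =
    (int_exp_laplace s)%:E.
  rewrite (@integral_itv_bndoo _ _ _ _ false false); last exact: measurable_funTS.
  rewrite -(int_exp_laplaceE theta_gt0 nuXE).
  apply: eq_integral => z; rewrite inE/= in_itv/= => /andP[z0 zs].
  by rewrite KX_reward_early ?z0 ?ltW// -EFinM mulrC.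
pose f z := expR z * (smooth_value z + value_slope * gamma_density z).
have df z : s <= z <= y -> is_derive z 1 (fun z => expR z * smooth_value z) (f z).
  move=> /andP[sz _]; have d1 := is_derive_smooth_value (lt_le_trans s2_lt sz).
  by apply: is_derive_eq; rewrite /GRing.scale/= /f; ring.
have cf z : s <= z <= y -> {for z, continuous f}.
  move=> /andP[sz _]; apply: cvgM; first exact: continuous_expR.
  apply: cvgD.
    have d := is_derive_smooth_value (lt_le_trans s2_lt sz).
    exact/differentiable_continuous/derivable1_diffP.
  apply: cvgM; first exact: cvg_cst.
  by apply: continuous_gamma_integrand; exact: lt_le_trans sz.
have fE z : z \in `]s, y[%classic -> (KX nuX (EFin \o reward) z * (expR z)%:E)%E = (f z)%:E.
  rewrite inE/= in_itv/= => /andP[sz zy].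
  by rewrite KX_reward_late// late_valueE ?ltW// -EFinM mulrC.
have -> : (\int[lam]_(z in `]s, y[) (KX nuX (EFin \o reward) z * (expR z)%:E))%E =
    (expR y * smooth_value y - expR s * smooth_value s)%:E.
  rewrite -(integral_is_derive (ltW sy) df cf) [RHS](@integral_itv_bndoo _ _ _ _ true false).
    by apply: eq_integral => z; exact: fE.
  by apply: eq_measurable_fun (measurable_funTS mU) => z; exact: fE.
have -> : smooth_value s = single_record s by rewrite -late_valueE// late_value_start.
rewrite -EFinD -EFinM late_valueE ?ltW//; congr EFin.
have -> : int_exp_laplace s = expR s * single_record s.
  by rewrite /single_record mulrA -expRD subrr expR0 mul1r.
by rewrite addrC subrK mulrA -expRD addNr expR0 mul1r.
Qed.

End value.

Section upper_gamma_limit.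
Context {R : realType}.
Variables (theta : R) (theta_gt0 : 0 < theta) (s : R) (s_gt0 : 0 < s).
Local Notation lam := (@lebesgue_measure R).
Let gamma_density (t : R) := expR (- t) * t `^ (- theta + 1 - 1).

Lemma integral_exp_tail (k T : R) : 0 <= k ->
  (\int[lam]_(t in `]T, +oo[) (k * expR (- t))%:E)%E = (k * expR (- T))%:E.
Proof.
move=> k0.
have cE z : {for z, continuous (fun t : R => expR (- t))}.
  apply: (@continuous_comp _ _ _ (fun z : R => - z) expR); first exact: cvgN.
  exact: continuous_expR.
have dF (z : R) : is_derive z 1 (fun t : R => - (k * expR (- t))) (k * expR (- z)).
  by apply: is_derive_eq; rewrite /GRing.scale/=; ring.
rewrite integral_itv_obnd_cbnd; last first.
  by apply/measurable_EFinP/measurable_funTS/measurable_funM => //; exact: measurableT_comp.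
rewrite (@ge0_continuous_FTC2y _ _ (fun t => - (k * expR (- t))) T 0).
- by rewrite -EFinB sub0r opprK.
- by move=> x _; rewrite mulr_ge0 ?expR_ge0.
- apply: continuous_subspaceT => x; apply: cvgM; [exact: cvg_cst|exact: cE].
- rewrite -oppr0 -(mulr0 k); apply: cvgN; apply: cvgM; first exact: cvg_cst.
  exact: cvgr_expR.
- by move=> x _; apply: ex_derive.
- apply: cvg_at_right_filter; apply: cvgN; apply: cvgM; [exact: cvg_cst|exact: cE].
- by move=> x _; rewrite derive1E derive_val.
Qed.

Lemma integrable_gamma_upper : lam.-integrable `]s, +oo[ (EFin \o gamma_density).
Proof.
pose k := (s `^ theta)^-1.
have k0 : 0 <= k by rewrite invr_ge0 powR_ge0.
apply: (@le_integrable _ _ _ _ _ _ _ (EFin \o (fun t : measurableTypeR R => k * expR (- t)))) => //.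
- by apply/measurable_EFinP; exact: measurable_gamma_integrand.
- move=> t /=; rewrite in_itv/= andbT => /ltW st.
  rewrite !lee_fin !ger0_norm ?mulr_ge0 ?expR_ge0 ?powR_ge0//.
  exact: gamma_density_le.
apply/integrableP; split.
  by apply/measurable_EFinP/measurable_funTS/measurable_funM => //; exact: measurableT_comp.
under eq_integral do rewrite gee0_abs ?lee_fin ?mulr_ge0 ?expR_ge0//.
by rewrite integral_exp_tail// ltry.
Qed.

Lemma inc_gamma_tail (T : R) : s <= T ->
  0 <= inc_gamma (- theta + 1) s%:E +oo - inc_gamma (- theta + 1) s%:E T%:E
    <= (s `^ theta)^-1 * expR (- T).
Proof.
move=> sT; have g0 t : 0 <= gamma_density t by rewrite mulr_ge0 ?expR_ge0 ?powR_ge0.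
have -> : inc_gamma (- theta + 1) s%:E T%:E = \int[lam]_(t in `]s, T]) gamma_density t.
  rewrite inc_gammaE /Rintegral (@integral_itv_bndoo _ _ _ _ false false)//.
  by apply/measurable_EFinP; exact: measurable_gamma_integrand.
have iT : lam.-integrable `]T, +oo[ (EFin \o gamma_density).
  apply: integrableS integrable_gamma_upper => // x /=.
  by rewrite !in_itv/= !andbT; exact: le_lt_trans.
rewrite inc_gammayE Rintegral_itvB ?bnd_simp//; last exact: integrable_gamma_upper.
apply/andP; split; first by apply: Rintegral_ge0 => t _; exact: g0.
rewrite -lee_fin /Rintegral fineK; last by apply: integrable_fin_num.
rewrite -integral_exp_tail ?invr_ge0 ?powR_ge0//.
apply: ge0_le_integral => //.
- by move=> t _; exact: g0.
- by apply/measurable_EFinP; exact: measurable_gamma_integrand.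
- by apply/measurable_EFinP/measurable_funTS/measurable_funM => //; exact: measurableT_comp.
- move=> t /=; rewrite in_itv/= andbT => Tt; rewrite lee_fin.
  by apply: gamma_density_le => //; rewrite (le_trans sT)// ltW.
Qed.

Lemma cvg_inc_gamma_upper :
  inc_gamma (- theta + 1) s%:E T%:E @[T --> +oo] --> inc_gamma (- theta + 1) s%:E +oo.
Proof.
pose L := inc_gamma (- theta + 1) s%:E +oo.
apply: (@squeeze_cvgr _ _ _ _ (fun T => L - (s `^ theta)^-1 * expR (- T)) (cst L)).
- near=> T; have sT : s <= T by near: T; apply: nbhs_pinfty_ge; exact: num_real.
  have /andP[t0 t1] := inc_gamma_tail sT.
  by rewrite /= -/L lerBlDr -lerBlDl t1 -subr_ge0 t0.
- rewrite -[X in _ --> X]subr0 -(mulr0 ((s `^ theta)^-1)); apply: cvgB; first exact: cvg_cst.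
  by apply: cvgM; [exact: cvg_cst|exact: cvgr_expR].
- exact: cvg_cst.
Unshelve. all: by end_near. Qed.

End upper_gamma_limit.

(** * Domination by the reward at the root *)

Section at_root.
Context {R : realType}.
Variables (theta : R) (nuX : probability R R).
Hypothesis theta_gt0 : 0 < theta.
Hypothesis nuXE : forall A, measurable A -> nuX A = beta1_prob theta A.
Variables (s : R) (s_gt0 : 0 < s).
Hypothesis s_root : int_exp_laplace theta s = 1.

Lemma single_record_root : single_record theta s = expR (- s).
Proof. by rewrite /single_record s_root mulr1. Qed.

Lemma value_slope_root : value_slope theta s =
  - s `^ theta + expR s * theta * inc_gamma theta 0%:E s%:E.
Proof.
rewrite /value_slope single_record_root /laplace expRN.
have e0 : expR s != 0 by rewrite gt_eqF// expR_gt0.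
have st : s `^ theta != 0 by rewrite gt_eqF// powR_gt0.
by field; rewrite e0 st.
Qed.

(** Of the two ends of the convex combination in [late_value_convex], one equals [expR (- s)] at the
    root and the other, [laplace s], is at least that. *)
Lemma late_value_root (y : R) : s <= y -> expR (- s) <= late_value theta s y.
Proof.
move=> /(late_value_convex theta_gt0 s_gt0)[l /andP[l0 l1] ->].
have := laplace_ge theta_gt0 nuXE s_gt0.
rewrite single_record_root => q; nra.
Qed.

Lemma no_record_le_reward (y : R) : no_record y <= reward theta s y.
Proof.
have [y0|y0] := leP y 0; first by rewrite no_record_le0// /reward early_late_le0.
rewrite no_recordE//; have [ys|sy] := leP y s; first by rewrite /reward early_lateL ?y0.
rewrite /reward early_lateR//; apply: le_trans (late_value_root (ltW sy)).
by rewrite ler_expR lerN2 ltW.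
Qed.

(** Only [(0, s]] matters: there [int_exp_laplace], which is increasing and reaches 1 at the root,
    is at most 1, so stopping is at least as good as waiting for one more record. *)
Lemma value_le_reward (y : R) : value theta s y <= reward theta s y.
Proof.
have [y0|y0] := leP y 0; first by rewrite /value /reward !early_late_le0.
have [ys|sy] := leP y s; last by rewrite /value /reward !early_lateR.
rewrite /value /reward !early_lateL ?y0//.
rewrite /single_record ger_pMr ?expR_gt0// -s_root.
move: ys; rewrite le_eqVlt => /predU1P[->//|ys]; apply: ltW.
exact: (int_exp_laplace_incr theta_gt0 nuXE).
Qed.

End at_root.

(** * Paths of the record process *)

Section paths.
Context (Omega : Type) (R : realType).
Variables (X E : nat -> Omega -> R).
Hypothesis X01 : forall n w, 0 <= X n w <= 1.
Hypothesis E0 : forall n w, 0 <= E n w.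
Local Notation S := (state 1 X).
Local Notation tau := (jump_time 1 X E).
Local Notation Z := (record_process 1 X E).

Lemma stateS n w : S n.+1 w = S n w * X n w.
Proof. by rewrite /state big_ord_recr/= mulrA. Qed.

Lemma jump_timeS n w : tau n.+1 w = tau n w + E n w / S n w.
Proof. by rewrite /jump_time big_ord_recr. Qed.

Lemma jump_time0 w : tau 0 w = 0.
Proof. by rewrite /jump_time big_ord0. Qed.

Lemma state_ge0 n w : 0 <= S n w.
Proof. by rewrite /state mul1r prodr_ge0// => j _; case/andP: (X01 j w). Qed.

Lemma state_noninc w m n : (m <= n)%N -> S n w <= S m w.
Proof.
move=> mn; rewrite -(subnKC mn); elim: (n - m)%N => [|k IH]; first by rewrite addn0.
rewrite addnS stateS (le_trans _ IH)// ler_piMr ?state_ge0//.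
by case/andP: (X01 (m + k)%N w).
Qed.

Lemma jump_time_nondec w m n : (m <= n)%N -> tau m w <= tau n w.
Proof.
move=> mn; rewrite -(subnKC mn); elim: (n - m)%N => [|k IH]; first by rewrite addn0.
by rewrite addnS jump_timeS (le_trans IH)// lerDl divr_ge0// state_ge0.
Qed.

Lemma jump_time_ge0 n w : 0 <= tau n w.
Proof. by rewrite -(jump_time0 w) jump_time_nondec. Qed.

Lemma jump_time_lt w m n : tau m w < tau n w -> (m < n)%N.
Proof. by rewrite ltnNge => t; apply/negP => /(jump_time_nondec w); rewrite leNgt t. Qed.

Lemma process_le n t w : tau n w <= t -> Z t w <= S n w.
Proof.
by move=> nt; apply: ge_inf; [exists 0 => _ [k _ <-]; exact: state_ge0|exists n].
Qed.

Lemma process_ge a t w : 0 <= t -> (forall n, tau n w <= t -> a <= S n w) -> a <= Z t w.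
Proof.
move=> t0 H; apply: lb_le_inf; first by exists (S 0 w), 0 => //=; rewrite jump_time0.
by move=> _ [n /= nt <-]; exact: H.
Qed.

(** A strict upper bound on an infimum has a witness, which turns events of the process into
    countable unions over the jumps. *)
Lemma process_ltP a t w : 0 <= t ->
  Z t w < a <-> exists n, tau n w <= t /\ S n w < a.
Proof.
move=> t0; split => [Za|[n [nt Sa]]]; last exact: le_lt_trans (process_le nt) Sa.
apply: contrapT => /forallNP H; move: Za; rewrite ltNge => /negP; apply.
apply: process_ge => // n nt; rewrite leNgt; apply/negP => Sa.
by apply: (H n).
Qed.

Lemma process_noninc t u w : 0 <= t -> t <= u -> Z u w <= Z t w.
Proof.
by move=> t0 tu; apply: process_ge => // n nt; apply: process_le; exact: le_trans tu.
Qed.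

Lemma process_ge0 t w : 0 <= t -> 0 <= Z t w.
Proof. by move=> t0; apply: process_ge => // n _; exact: state_ge0. Qed.

Lemma process_eq n t w : tau n w <= t -> (forall m, tau m w <= t -> S n w <= S m w) ->
  Z t w = S n w.
Proof.
move=> nt H; apply/le_anti; rewrite process_le//=; apply: process_ge => //.
by rewrite (le_trans _ nt)// jump_time_ge0.
Qed.

(** Jump times are nondecreasing in the index, so those beyond [t], if any, have a least element.
    This also holds when jump times accumulate before [t]. *)
Lemma process_right_const t w : 0 <= t ->
  exists2 u, t < u & forall v, t <= v < u -> Z v w = Z t w.
Proof.
move=> t0; suff [u tu H] : exists2 u, t < u & forall n, tau n w < u -> tau n w <= t.
  exists u => // v /andP[tv vu]; apply/le_anti; rewrite process_noninc//=.
  apply: process_ge; first exact: le_trans tv.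
  by move=> n nv; apply: process_le; apply: H; exact: le_lt_trans vu.
have [H|/existsNP ex] := pselect (forall n, tau n w <= t).
  by exists (t + 1); rewrite ?ltrDl.
have ex' : exists n, t < tau n w.
  by case: ex => n /negP; rewrite -ltNge => tn; exists n.
exists (tau (ex_minn ex') w); case: ex_minnP => n // tn min_n k kn.
rewrite leNgt; apply/negP => /min_n; rewrite leqNgt => /negP; apply.
exact: jump_time_lt kn.
Qed.

Lemma left_limit_jump k t w : tau k w < t <= tau k.+1 w ->
  lim (Z u w @[u --> t^'-]) = S k w.
Proof.
move=> /andP[kt tk]; apply/cvg_lim => //; apply: cvg_near_cst.
near=> u; apply: process_eq.
  by near: u; exact: nbhs_left_ge.
move=> m mu; apply: state_noninc; rewrite -ltnS; apply: (@jump_time_lt w).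
by rewrite (lt_le_trans _ tk)// (le_lt_trans mu)//; near: u; exact: nbhs_left_lt.
Unshelve. all: by end_near. Qed.

(** States close to the infimum are reached before [t], so the path is left-continuous there: an
    accumulation point of jump times is not a record. *)
Lemma left_limit_accumulation t w : 0 < t -> (forall k, tau k w < t) ->
  lim (Z u w @[u --> t^'-]) = Z t w.
Proof.
move=> t0 H; apply/cvg_lim => //; apply/cvgrPdist_lt => e e0.
have [|n [nt Sn]] := (process_ltP (Z t w + e) w (ltW t0)).1; first by rewrite ltrDl.
near=> u; have nu : tau n w <= u by near: u; exact: nbhs_left_ge.
have ut : u <= t by apply: ltW; near: u; exact: nbhs_left_lt.
have u0 : 0 <= u by rewrite (le_trans _ nu)// jump_time_ge0.
rewrite distrC ger0_norm ?subr_ge0 ?process_noninc//.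
by rewrite ltrBlDl (le_lt_trans (process_le nu)).
Unshelve. all: by end_near. Qed.

End paths.

Section records.
Context d (Omega : measurableType d) (R : realType).
Variables (X E : nat -> Omega -> R).
Hypothesis X01 : forall n w, 0 <= X n w <= 1.
Hypothesis E0 : forall n w, 0 <= E n w.
Local Notation S := (state 1 X).
Local Notation tau := (jump_time 1 X E).
Local Notation Z := (record_process 1 X E).
Let process_ltP := @process_ltP _ _ X E X01.
Let jump_time0 := jump_time0 X E.
Let jump_time_lt := @jump_time_lt _ _ X E X01 E0.
Let state_noninc := @state_noninc _ _ X X01.
Let left_limit_jump := @left_limit_jump _ _ X E X01 E0.

(** The ranges allow factors equal to 1 and zero sojourn times, so a jump need not be a record and
    several jumps may share one time. Hence the comparison with every state entered before [t]. *)
Lemma record_atP t w : record_at Z t w <->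
  0 < t /\ exists m, tau m w = t /\ forall k, tau k w < t -> S m w < S k w.
Proof.
rewrite /record_at; split=> -[t0 H]; split=> //.
- have [acc|] := pselect (forall k, tau k w < t).
    by move: H; rewrite (left_limit_accumulation X01 E0)// ltxx.
  move=> /existsNP ex; have ex' : exists n, t <= tau n w.
    by case: ex => n /negP; rewrite -leNgt => tn; exists n.
  have [[|k] tk min_k] := ex_minnP ex'; first by move: tk; rewrite jump_time0 leNgt t0.
  have kt : tau k w < t by rewrite ltNge; apply/negP => /min_k; rewrite ltnn.
  move: H; rewrite (@left_limit_jump k) ?kt// => /(process_ltP _ _ (ltW t0))[m [mt Sm]].
  exists m; split.
    apply/le_anti; rewrite mt/= leNgt; apply/negP => mt'.
    have : (m <= k)%N by rewrite -ltnS; apply: (@jump_time_lt w); exact: lt_le_trans tk.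
    by move=> /(state_noninc w); rewrite leNgt Sm.
  move=> j jt; rewrite (lt_le_trans Sm)//; apply: state_noninc.
  by rewrite -ltnS; apply: (@jump_time_lt w); exact: lt_le_trans tk.
- move: H => [m [mt H]].
  have ex' : exists n, t <= tau n w by exists m; rewrite mt.
  have [[|k] tk min_k] := ex_minnP ex'; first by move: tk; rewrite jump_time0 leNgt t0.
  have kt : tau k w < t by rewrite ltNge; apply/negP => /min_k; rewrite ltnn.
  rewrite (@left_limit_jump k) ?kt//; apply/(process_ltP _ _ (ltW t0)).
  by exists m; rewrite mt lexx; split => //; exact: H.
Qed.

Lemma record_time t w : record_at Z t w -> exists n, tau n w = t.
Proof. by move=> /record_atP[_ [m [<- _]]]; exists m. Qed.

(** The gap is uniform over all earlier times, so it survives testing at rational times with a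
    margin [i.+1%:R^-1]; see [policy_eventP]. *)
Lemma record_gap u w : record_at Z u w ->
  exists c, Z u w < c /\ forall v, 0 <= v < u -> c <= Z v w.
Proof.
move=> /record_atP[u0 [m [mu H]]].
have ex' : exists n, u <= tau n w by exists m; rewrite mu.
have [[|k] tk min_k] := ex_minnP ex'; first by move: tk; rewrite jump_time0 leNgt u0.
have ku : tau k w < u by rewrite ltNge; apply/negP => /min_k; rewrite ltnn.
exists (S k w); split.
  by rewrite (le_lt_trans (process_le X01 (n := m) _)) ?mu ?H.
move=> v /andP[v0 vu]; apply: process_ge => // j jv; apply: state_noninc.
by rewrite -ltnS; apply: (@jump_time_lt w); rewrite (lt_le_trans _ tk)// (le_lt_trans jv).
Qed.

End records.

Section measurability.
Context d (T : measurableType d) (R : realType).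
Variables (X E : nat -> T -> R).
Local Notation S := (state 1 X).
Local Notation tau := (jump_time 1 X E).
Local Notation Z := (record_process 1 X E).

(** Measurability is assumed only for the variables that occur, so that the lemma applies to the
    sigma-algebra of a finite past. *)
Lemma measurable_state n : (forall j, (j < n)%N -> measurable_fun setT (X j)) ->
  measurable_fun setT (S n).
Proof.
elim: n => [_|n IH mX].
  rewrite (_ : S 0 = cst 1)//; apply/funext => w.
  by rewrite /state big_ord0 mulr1.
rewrite (_ : S n.+1 = S n \* X n)%R; last by apply/funext => w; rewrite stateS.
apply: measurable_funM; last exact: mX.
by apply: IH => j jn; apply: mX; exact: ltnW.
Qed.

Lemma measurable_jump_time n : (forall j, (j < n)%N -> measurable_fun setT (X j)) ->
  (forall j, (j < n)%N -> measurable_fun setT (E j)) ->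
  measurable_fun setT (tau n).
Proof.
elim: n => [_ _|n IH mX mE].
  by rewrite (_ : tau 0 = cst 0)//; apply/funext => w; rewrite jump_time0.
rewrite (_ : tau n.+1 = (fun w => tau n w + E n w * (S n w)^-1)); last first.
  by apply/funext => w; rewrite jump_timeS.
apply: measurable_funD.
  by apply: IH => j jn; [apply: mX|apply: mE]; exact: ltnW.
apply: measurable_funM; first exact: mE.
apply: (measurableT_comp measurable_invr); apply: measurable_state => j jn.
by apply: mX; exact: ltnW.
Qed.

Lemma measurable_set_lt (f g : T -> R) : measurable_fun setT f -> measurable_fun setT g ->
  measurable [set w | f w < g w].
Proof.
move=> mf mg; have := measurable_fun_ltr mf mg measurableT (I : measurable [set true]).
by rewrite setTI preimage_true.
Qed.

Lemma measurable_set_le (f g : T -> R) : measurable_fun setT f -> measurable_fun setT g ->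
  measurable [set w | f w <= g w].
Proof.
move=> mf mg; have := measurable_fun_ler mf mg measurableT (I : measurable [set true]).
by rewrite setTI preimage_true.
Qed.

Lemma measurable_set_eq (f g : T -> R) : measurable_fun setT f -> measurable_fun setT g ->
  measurable [set w | f w = g w].
Proof.
move=> mf mg; rewrite (_ : [set w | _] = [set w | f w <= g w] `&` [set w | g w <= f w]).
  by apply: measurableI; exact: measurable_set_le.
apply/seteqP; split => w /=; first by move->.
by case=> fg gf; apply/le_anti; rewrite fg.
Qed.

Hypothesis X01 : forall n w, 0 <= X n w <= 1.
Hypothesis mX : forall n, measurable_fun setT (X n).
Hypothesis mE : forall n, measurable_fun setT (E n).

Let mS n : measurable_fun setT (S n).
Proof. by apply: measurable_state. Qed.

Let mtau n : measurable_fun setT (tau n).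
Proof. by apply: measurable_jump_time. Qed.

Lemma measurable_process_at (t : T -> R) : (forall w, 0 <= t w) ->
  measurable_fun setT t -> measurable_fun setT (fun w => Z (t w) w).
Proof.
move=> t0 mt; apply: (measurability _ (RGenInftyO.measurableE R)) => // _ [_ [a ->] <-].
rewrite setTI (_ : _ @^-1` _ = \bigcup_k ([set w | tau k w <= t w] `&` [set w | S k w < a])).
  apply: bigcup_measurable => k _; apply: measurableI; first exact: measurable_set_le.
  exact: measurable_set_lt.
apply/seteqP; split => w /=; rewrite in_itv/= process_ltP//.
  by case=> k [? ?]; exists k.
by case=> k _ [? ?]; exists k.
Qed.

End measurability.

Section measurable_events.
Context d (Omega : measurableType d) (R : realType).
Variables (X E : nat -> Omega -> R).
Hypothesis X01 : forall n w, 0 <= X n w <= 1.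
Hypothesis E0 : forall n w, 0 <= E n w.
Hypothesis mX : forall n, measurable_fun setT (X n).
Hypothesis mE : forall n, measurable_fun setT (E n).
Local Notation S := (state 1 X).
Local Notation tau := (jump_time 1 X E).
Local Notation Z := (record_process 1 X E).

Let mS n : measurable_fun setT (S n).
Proof. by apply: measurable_state. Qed.

Let mtau n : measurable_fun setT (tau n).
Proof. by apply: measurable_jump_time. Qed.

Lemma measurable_record_at n : measurable [set w | record_at Z (tau n w) w].
Proof.
rewrite (_ : [set w | _] = [set w | 0 < tau n w] `&`
    \bigcup_m ([set w | tau m w = tau n w] `&`
      \bigcap_k (~` [set w | tau k w < tau n w] `|` [set w | S m w < S k w]))).
  apply: measurableI; first exact: measurable_set_lt.
  apply: bigcup_measurable => m _; apply: measurableI; first exact: measurable_set_eq.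
  apply: bigcapT_measurable => k; apply: measurableU; last exact: measurable_set_lt.
  by apply: measurableC; exact: measurable_set_lt.
apply/seteqP; split => w /=; rewrite record_atP//.
  move=> [t0 [m [mn H]]]; split=> //; exists m => //; split=> // k _ /=.
  by have [kn|kn] := ltP (tau k w) (tau n w); [right; apply: H|left].
move=> [t0 [m _ [mn H]]]; split=> //; exists m; split=> // k kn.
by have [|//] := H k I; rewrite /= kn.
Qed.

Lemma measurable_one_record (s : R) :
  measurable [set w | exists! t, record_at Z t w /\ t < s].
Proof.
pose A n := [set w | record_at Z (tau n w) w] `&` [set w | tau n w < s].
have mA n : measurable (A n).
  by apply: measurableI; [exact: measurable_record_at|exact: measurable_set_lt].
rewrite (_ : [set w | _] = (\bigcup_n A n) `&`
    \bigcap_n \bigcap_m (~` (A n `&` A m) `|` [set w | tau n w = tau m w])).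
  apply: measurableI; first exact: bigcup_measurable.
  apply: bigcapT_measurable => n; apply: bigcapT_measurable => m.
  apply: measurableU; last exact: measurable_set_eq.
  by apply: measurableC; exact: measurableI.
apply/seteqP; split => w /=.
  move=> [t [[rt ts] uniq_t]]; have [n tn] := record_time X01 E0 rt.
  split; first by exists n => //; split; rewrite /= tn.
  move=> i _ j _ /=; have [[[ri si] [rj sj]]|] := pselect ((A i `&` A j) w); last by left.
  by right; rewrite -(uniq_t _ (conj ri si)) -(uniq_t _ (conj rj sj)).
move=> [[n _ [rn ns]] H]; exists (tau n w); split=> // t [rt ts].
have [m tm] := record_time X01 E0 rt; rewrite -tm.
have [nA|//] := H n I m I; exfalso; apply: nA.
by split; split; rewrite /= ?tm.
Qed.

Lemma measurable_success (T : R) (pi : Omega -> \bar R) : 0 < T ->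
  measurable_fun setT pi -> measurable (success Z T pi).
Proof.
move=> T0 mpi.
rewrite (_ : success Z T pi = \bigcup_n ([set w | pi w \is a fin_num] `&`
    [set w | fine (pi w) = tau n w] `&` [set w | tau n w < T] `&`
    [set w | record_at Z (tau n w) w] `&` [set w | Z (tau n w) w = Z T w])).
  apply: bigcup_measurable => n _; apply: measurableI; last first.
    apply: measurable_set_eq; first apply: (@measurable_process_at _ _ _ X E X01 mX mE (tau n)) => // w.
      exact: jump_time_ge0.
    by apply: (@measurable_process_at _ _ _ X E X01 mX mE (cst T)) => // w; exact: ltW.
  apply: measurableI; last exact: measurable_record_at.
  apply: measurableI; last exact: measurable_set_lt.
  apply: measurableI; first by rewrite -[X in measurable X]setTI; exact: emeasurable_fin_num.
  by apply: measurable_set_eq => //; exact: measurableT_comp.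
apply/seteqP; split => w.
  move=> [t [pt tT rt ZT]]; have [n tn] := record_time X01 E0 rt.
  by exists n => //; rewrite /= tn pt.
move=> [n _ [[[[/= pf pt] nT] rn] ZT]]; exists (tau n w); split=> //.
by rewrite -pt fineK.
Qed.

Lemma natural_filtration_measurable (t : R) : 0 <= t ->
  natural_filtration Z t `<=` measurable.
Proof.
move=> t0; apply: smallest_sub; first exact: sigma_algebra_measurable.
move=> A [u]; rewrite /= in_itv/= => /andP[u0 _] [B mB <-].
apply: (@measurable_process_at _ _ _ X E X01 mX mE (cst u)) => //.
Qed.

Lemma stopping_time_measurable (pi : Omega -> \bar R) : stopping_time Z pi ->
  measurable_fun setT pi.
Proof.
move=> [pi0 H]; apply: (measurability _ (ErealGenOInfty.measurableE R)) => // _ [_ [a ->] <-].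
rewrite setTI (_ : _ @^-1` _ = ~` [set w | (pi w <= a%:E)%E]); last first.
  by apply/seteqP; split => w /=; rewrite in_itv/= andbT ltNge => /negP.
apply: measurableC; have [a0|a0] := leP 0 a; last first.
  rewrite (_ : [set w | _] = set0)//; apply/seteqP; split => w //= piw.
  by have := le_trans (pi0 w) piw; rewrite lee_fin leNgt a0.
(* The right limit of the filtration at [a] is contained in the filtration at any later time, here
   [a + 1]. *)
apply: (@natural_filtration_measurable (a + 1)); first by rewrite addr_ge0.
by apply: (H a a0); rewrite /= in_itv/= andbT ltrDl.
Qed.

End measurable_events.

(** * Stopping times *)

Section filtration.
Context d (Omega : measurableType d) (R : realType).
Variable Z : R -> Omega -> R.

Definition filtrationType (t : R) : measurableType _ :=
  g_sigma_algebraType (\bigcup_(u in `[0, t]) preimage_set_system setT (Z u) measurable).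

Lemma measurable_filtration (u t : R) : 0 <= u <= t ->
  measurable_fun (setT : set (filtrationType t)) (Z u).
Proof.
move=> ut _ B mB; apply: sub_sigma_algebra; exists u => //.
by exists B.
Qed.

Lemma natural_filtration_mono (t u : R) : t <= u ->
  natural_filtration Z t `<=` natural_filtration Z u.
Proof.
move=> tu; apply: smallest_sub; first exact: smallest_sigma_algebra.
move=> A [v]; rewrite /= in_itv/= => /andP[v0 vt] [B mB <-].
apply: sub_sigma_algebra; exists v; last by exists B.
by rewrite /= in_itv/= v0 (le_trans vt).
Qed.

(* Strict inequalities need no right limit of the filtration. *)
Lemma stopping_time_lt (pi : Omega -> \bar R) (t : R) : stopping_time Z pi ->
  0 <= t -> natural_filtration Z t [set w | (pi w < t%:E)%E].
Proof.
move=> [pi0 H] t0; rewrite -[natural_filtration Z t _]/(measurable (_ : set (filtrationType t))).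
rewrite (_ : [set w | _] = \bigcup_i [set w | (pi w <= (t - i.+1%:R^-1)%:E)%E]).
  apply: bigcup_measurable => i _; have [ti|ti] := leP 0 (t - i.+1%:R^-1).
    by apply: (H _ ti); rewrite /= in_itv/= andbT ltrBlDr ltrDl.
  have -> : [set w | (pi w <= (t - i.+1%:R^-1)%:E)%E] = set0; last exact: measurable0.
  apply/seteqP; split => w //= piw.
  by have := le_trans (pi0 w) piw; rewrite lee_fin leNgt ti.
apply/seteqP; split => w /=.
  move=> pit; have [r pr] : exists r, pi w = r%:E.
    by move: pit (pi0 w); case: (pi w) => // r _ _; exists r.
  move: pit; rewrite pr lte_fin => /ltr_add_invr[i ri]; exists i => //=.
  by rewrite pr lee_fin lerBrDr ltW.
move=> [i _ /=] /le_lt_trans; apply.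
by rewrite lte_fin ltrBlDr ltrDl.
Qed.

End filtration.

Section policy.
Context d (Omega : measurableType d) (R : realType).
Variables (X E : nat -> Omega -> R).
Hypothesis X01 : forall n w, 0 <= X n w <= 1.
Hypothesis E0 : forall n w, 0 <= E n w.
Hypothesis mX : forall n, measurable_fun setT (X n).
Hypothesis mE : forall n, measurable_fun setT (E n).
Local Notation S := (state 1 X).
Local Notation tau := (jump_time 1 X E).
Local Notation Z := (record_process 1 X E).
Variables (T s : R).

Let admissible (w : Omega) : set R :=
  [set t | [/\ record_at Z t w, t < T & (T - t) * Z t w <= s]].

(** Admissible times are jump times, and these are ordered by their index, so the least admissible
    index gives the least admissible time. *)
Lemma policy_attained w u : admissible w u ->
  exists v, [/\ admissible w v, policy Z T s w = v%:E & forall t, admissible w t -> v <= t].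
Proof.
move=> Au; have [n0 n0u] : exists n, `[< admissible w (tau n w) >].
  case: (Au) => ru _ _; have [n nu] := record_time X01 E0 ru.
  by exists n; apply/asboolP; rewrite nu.
have ex : exists n, `[< admissible w (tau n w) >] by exists n0.
have [n /asboolP An min_n] := ex_minnP ex.
have n_min t : admissible w t -> tau n w <= t.
  move=> At; case: (At) => rt _ _; have [m mt] := record_time X01 E0 rt.
  rewrite -mt; apply: jump_time_nondec => //; apply: min_n; apply/asboolP.
  by rewrite mt.
exists (tau n w); split => //; apply/le_anti/andP; split.
  by apply: ereal_inf_lbound; exists (tau n w).
by apply: le_ereal_inf_tmp => _ [t At <-]; rewrite lee_fin; exact: n_min.
Qed.

Lemma policy_leP w t : (policy Z T s w <= t%:E)%E <-> exists2 u, admissible w u & u <= t.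
Proof.
split=> [pt|[u Au ut]].
  have [[u Au]|/forallNP none] := pselect (exists u, admissible w u).
    have [v [Av pv _]] := policy_attained Au.
    by exists v => //; rewrite -lee_fin -pv.
  move: pt; rewrite /policy (_ : [set _ | _ in _] = set0) ?ereal_inf0//.
  by apply/seteqP; split => x // [u Au _]; apply: (none u).
by rewrite (le_trans _ (_ : u%:E <= t%:E)%E) ?lee_fin//; apply: ereal_inf_lbound; exists u.
Qed.

(** Describes the policy having stopped by [t < T] through countably many values of the process. The
    threshold has been crossed, and the process has dropped by a fixed margin below its initial
    value and below every earlier value that did not meet the threshold. The margin excludes a
    crossing by mere lapse of time with no record since; time 0 is included because it is not a
    record. *)
Let event (t : R) : set Omega := [set w | (T - t) * Z t w <= s] `&`
  \bigcup_i \bigcap_(q : rat)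
    [set w | 0 <= (ratr q : R) <= t -> ratr q = 0 :> R \/ s < (T - ratr q) * Z (ratr q) w ->
      Z t w + i.+1%:R^-1 <= Z (ratr q) w].

Lemma policy_eventP w t : 0 <= t < T -> (policy Z T s w <= t%:E)%E <-> event t w.
Proof.
move=> /andP[t0 tT]; rewrite policy_leP; split.
  move=> [u [ru uT us] ut]; have u0 : 0 < u by case: ru.
  have g_noninc a b : 0 <= a -> a <= b -> b <= T -> (T - b) * Z b w <= (T - a) * Z a w.
    move=> a0 ab bT; rewrite ler_pM ?subr_ge0 ?process_ge0 ?lerB ?process_noninc//.
    exact: le_trans ab.
  have Zut : Z t w <= Z u w by apply: process_noninc => //; exact: ltW.
  split; first by rewrite /= (le_trans _ us)// g_noninc// ltW.
  have [c [uc Hc]] := record_gap X01 E0 ru.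
  have [i ic] := ltr_add_invr uc.
  exists i => // q _ /= /andP[q0 qt] Hq.
  have qu : ratr q < u.
    rewrite ltNge; apply/negP => uq; case: Hq => [q00|].
      by move: uq; rewrite q00 leNgt u0.
    by rewrite ltNge (le_trans _ us)// g_noninc// ?(ltW u0)// (le_trans qt)// ltW.
  by rewrite (le_trans _ (Hc _ _)) ?q0 ?qu// (le_trans _ (ltW ic))// lerD2r.
move=> [/= ts [i _ Hi]].
pose a := Z t w + i.+1%:R^-1.
have Hq (q : rat) : 0 <= (ratr q : R) <= t -> ratr q = 0 :> R \/ s < (T - ratr q) * Z (ratr q) w ->
  a <= Z (ratr q) w by exact: (Hi q I).
(* The least such jump is a record, since all states before it are at least [a]. *)
have ex : exists n, (tau n w <= t) && (S n w < a).
  have [|n [nt Sn]] := (@process_ltP _ _ X E X01 a _ w t0).1; first by rewrite ltrDl.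
  by exists n; rewrite nt.
have [n /andP[nt Sna] min_n] := ex_minnP ex.
have n0 : 0 < tau n w.
  rewrite lt_neqAle jump_time_ge0// andbT; apply/eqP => n0.
  have := Hq 0; rewrite rmorph0 lexx t0 => /(_ isT (or_introl erefl)).
  by rewrite leNgt (le_lt_trans (process_le _ _) Sna)// -n0.
exists (tau n w) => //; split; last 1 first.
- rewrite leNgt; apply/negP => gs.
  have nt' : tau n w < t.
    by rewrite lt_neqAle nt andbT; apply/eqP => E'; move: gs; rewrite E' ltNge ts.
  have [u nu Hu] := process_right_const X01 E0 w (ltW n0).
  (* If the threshold were not met at this jump, it would stay unmet for a time [e], because the
     process is at most 1 and constant just after the jump. A rational time in between contradicts
     the margin. *)
  pose e := (T - tau n w) * Z (tau n w) w - s.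
  have e0 : 0 < e by rewrite subr_gt0.
  have [|q] := @rat_in_itvoo _ (tau n w) (Num.min (Num.min u t) (tau n w + e)).
    by rewrite !lt_min nu nt' ltrDl.
  rewrite in_itv/= !lt_min => /andP[nq /andP[/andP[qu qt] qe]].
  have ZqE : Z (ratr q) w = Z (tau n w) w by apply: Hu; rewrite ltW.
  have q0 : 0 <= ratr q :> R by rewrite ltW// (lt_trans n0).
  have : a <= Z (ratr q) w.
    apply: Hq; first by rewrite q0 ltW.
    right; rewrite ZqE.
    have Z1 : Z (tau n w) w <= 1.
      have := @process_le _ _ X E X01 0 (tau n w) w.
      by rewrite jump_time0 /state big_ord0 mulr1; apply; exact: ltW.
    have Z0 : 0 <= Z (tau n w) w by apply: process_ge0 => //; exact: ltW.
    move: qe; rewrite /e; nra.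
  by rewrite leNgt (le_lt_trans (process_le _ (ltW nq)) Sna).
- apply/(record_atP X01 E0); split=> //; exists n; split=> // k kn.
  rewrite (lt_le_trans Sna)// leNgt; apply/negP => Ska.
  have := min_n k; rewrite (le_trans (ltW kn) nt) Ska => /(_ isT).
  by rewrite leqNgt (jump_time_lt X01 E0 kn).
- exact: le_lt_trans tT.
Qed.

Lemma event_natural_filtration t : 0 <= t -> natural_filtration Z t (event t).
Proof.
move=> t0; rewrite -[natural_filtration Z t _]/(measurable (_ : set (filtrationType Z t))).
have mZ u : 0 <= u <= t -> measurable_fun (setT : set (filtrationType Z t)) (Z u).
  exact: measurable_filtration.
have mZt : measurable_fun (setT : set (filtrationType Z t)) (Z t) by apply: mZ; rewrite t0 lexx.
apply: measurableI.
  by apply: measurable_set_le => //; exact: measurable_funM.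
apply: bigcup_measurable => i _; rewrite -[X in measurable X]setCK setC_bigcap.
  apply: measurableC; apply: bigcupT_measurable_rat => q; apply: measurableC.
have [qt|qt] := boolP (0 <= (ratr q : R) <= t); last first.
  by rewrite [X in measurable X](_ : _ = setT)//; apply/seteqP.
have mq := mZ _ qt.
rewrite [X in measurable X](_ : _ = [set w | ratr q <> 0 :> R /\ (T - ratr q) * Z (ratr q) w <= s]
  `|` [set w | Z t w + i.+1%:R^-1 <= Z (ratr q) w]).
  apply: measurableU.
    have [q0|q0] := pselect (ratr q = 0 :> R).
      by rewrite [X in measurable X](_ : _ = set0)//; apply/seteqP; split => w // -[].
    rewrite [X in measurable X](_ : _ = [set w | (T - ratr q) * Z (ratr q) w <= s]).
      by apply: measurable_set_le => //; exact: measurable_funM.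
    by apply/seteqP; split => w; [case|split].
  by apply: measurable_set_le => //; exact: measurable_funD.
apply/seteqP; split => w /=; last first.
  by move=> [[q0 qs] _ [//|]|//]; rewrite ltNge qs.
move=> H; have [//|nH] := pselect (Z t w + i.+1%:R^-1 <= Z (ratr q) w); first by right.
left; split=> [q0|]; first by apply: nH; apply: H => //; left.
by rewrite leNgt; apply/negP => qs; apply: nH; apply: H => //; right.
Qed.

Lemma policy_stopping_time : stopping_time Z (policy Z T s).
Proof.
split=> [w|t t0].
  by apply: le_ereal_inf_tmp => _ [t [[t0 _] _ _] <-]; rewrite lee_fin ltW.
suff H : natural_filtration Z t [set w | (policy Z T s w <= t%:E)%E].
  by move=> u; rewrite /= in_itv/= andbT => tu; apply: natural_filtration_mono H; exact: ltW.
have below u : 0 <= u < T -> natural_filtration Z u [set w | (policy Z T s w <= u%:E)%E].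
  move=> uT; rewrite (_ : [set w | _] = event u).
    by apply: event_natural_filtration; case/andP: uT.
  by apply/seteqP; split => w /(policy_eventP w uT).
have [tT|Tt] := ltP t T; first by apply: below; rewrite t0.
rewrite -[natural_filtration Z t _]/(measurable (_ : set (filtrationType Z t))).
(* Admissible times lie strictly before [T], so for [t >= T] the event is exhausted by times
   approaching [T] from below. *)
rewrite (_ : [set w | _] = \bigcup_i [set w | (policy Z T s w <= (T - i.+1%:R^-1)%:E)%E]).
  apply: bigcup_measurable => i _; have [Ti|Ti] := leP 0 (T - i.+1%:R^-1).
    apply: (natural_filtration_mono (t := T - i.+1%:R^-1)).
      by rewrite (le_trans _ Tt)// gerBl.
    by apply: below; rewrite Ti/= ltrBlDr ltrDl.
  have -> : [set w | (policy Z T s w <= (T - i.+1%:R^-1)%:E)%E] = set0; last exact: measurable0.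
  apply/seteqP; split => w //=.
  move=> /policy_leP[u [[u0 _] _ _] uT]; move: Ti; rewrite ltNge => /negP; apply.
  by rewrite (le_trans _ uT)// ltW.
apply/seteqP; split => w /=.
  move=> /policy_leP[u Au ut]; case: (Au) => _ uT _.
  have [i ui] := ltr_add_invr uT; exists i => //=; apply/policy_leP.
  by exists u => //; rewrite lerBrDr ltW.
move=> [i _ /policy_leP[u Au ui]]; apply/policy_leP; exists u => //.
by rewrite (le_trans ui)// (le_trans _ Tt)// gerBl.
Qed.

End policy.

Section determined.
Context d (Omega : measurableType d) (R : realType).
Variables (X E : nat -> Omega -> R).
Hypothesis X01 : forall n w, 0 <= X n w <= 1.
Hypothesis E0 : forall n w, 0 <= E n w.
Variables (n : nat) (G : set (set Omega)).
Local Notation TG := (g_sigma_algebraType G).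
Hypothesis mX : forall j, (j < n)%N -> measurable_fun (setT : set TG) (X j).
Hypothesis mE : forall j, (j < n)%N -> measurable_fun (setT : set TG) (E j).
Local Notation S := (state 1 X).
Local Notation tau := (jump_time 1 X E).
Local Notation Z := (record_process 1 X E).

(* The process frozen after its [n]-th jump. *)
Let X' (j : nat) : Omega -> R := if (j < n)%N then X j else cst 1.
Let E' (j : nat) : Omega -> R := if (j < n)%N then E j else cst 0.

Let X'01 j w : 0 <= X' j w <= 1.
Proof. by rewrite /X'; case: ifP => // _; rewrite ler01 lexx. Qed.

Let stateX' m : state 1 X' m = S (minn m n).
Proof.
apply/funext => w; elim: m => [|m IH]; first by rewrite min0n /state !big_ord0.
rewrite stateS IH /X'; case: ltnP => mn.
  by rewrite (minn_idPl mn : minn m.+1 n = m.+1) -stateS.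
by rewrite mulr1 (minn_idPr (leqW mn)).
Qed.

Let jump_timeX' m : jump_time 1 X' E' m = tau (minn m n).
Proof.
apply/funext => w; elim: m => [|m IH]; first by rewrite min0n !jump_time0.
rewrite jump_timeS IH stateX' /E'; case: ltnP => mn.
  by rewrite (minn_idPl mn : minn m.+1 n = m.+1) -jump_timeS.
by rewrite mul0r addr0 (minn_idPr (leqW mn)).
Qed.

Let processX' u w : u < tau n.+1 w -> Z u w = record_process 1 X' E' u w.
Proof.
move=> un; congr inf; apply/seteqP; split => _ [m /= mu <-]; last first.
  by exists (minn m n); rewrite /= ?stateX'// -jump_timeX'.
have mn : (m <= n)%N by rewrite -ltnS; apply: (jump_time_lt X01 E0 (w := w)); exact: le_lt_trans un.
by exists m; rewrite /= ?jump_timeX' ?stateX' (minn_idPl mn).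
Qed.

Lemma restricted_event (t : R) (A : set Omega) : 0 <= t -> natural_filtration Z t A ->
  exists B, <<s G >> B /\ forall w, t < tau n.+1 w -> A w <-> B w.
Proof.
move=> t0; move: A; apply: smallest_sub; last first.
  move=> A [u]; rewrite /= in_itv/= => /andP[u0 ut] [C mC <-].
  exists (record_process 1 X' E' u @^-1` C); split.
    have mX' j : measurable_fun (setT : set TG) (X' j).
      by rewrite /X'; case: ifP => // jn; exact: mX.
    have mE' j : measurable_fun (setT : set TG) (E' j).
      by rewrite /E'; case: ifP => // jn; exact: mE.
    have := @measurable_process_at _ TG _ X' E' X'01 mX' mE' (cst u) (fun=> u0)
      (@measurable_cst _ _ _ _ _ _) measurableT C mC.
    by rewrite setTI.
  by move=> w tw; rewrite /= processX' ?(le_lt_trans ut)//; split => [[]|].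
split.
- by exists set0; split => //; exact: (@measurable0 _ TG).
- move=> A [B [mB AB]]; exists (setT `\` B); split.
    by apply: (@measurableD _ TG) => //; exact: (@measurableT _ TG).
  by move=> w tw; rewrite /= AB.
- move=> F HF; have {HF}[B HB] := choice HF.
  exists (\bigcup_i B i); split.
    by apply: (@bigcup_measurable _ TG) => i _; have [] := HB i.
  move=> w tw; split=> -[i _ Hi]; exists i => //; have [_ H] := HB i; exact/(H w tw).
Qed.

(** The event is the difference of [pi <= tau n] and [pi < tau n]. Both are expressed by events
    [pi < q] at rational [q] before the next jump, where [restricted_event] applies. *)
Lemma stopping_determined (pi : Omega -> \bar R) : stopping_time Z pi ->
  exists D, <<s G >> D /\
    forall w, tau n w < tau n.+1 w -> pi w = (tau n w)%:E <-> D w.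
Proof.
move=> spi; have pi0 := spi.1.
have HB (q : rat) : exists B, <<s G >> B /\ (0 <= ratr q :> R ->
    forall w, ratr q < tau n.+1 w -> (pi w < (ratr q)%:E)%E <-> B w).
  have [q0|q0] := leP 0 (ratr q : R).
    by have [B [mB HB]] := restricted_event q0 (stopping_time_lt spi q0); exists B.
  (* A default at negative [q], where the filtration gives no information. *)
  by exists set0; split=> //; exact: (@measurable0 _ TG).
have {HB}[B HB] := choice HB.
have mB q : <<s G >> (B q) by have [] := HB q.
have mtau : measurable_fun (setT : set TG) (tau n) by apply: measurable_jump_time.
(* [pi <= tau n] holds when [pi < q] for all rationals just to the right of [tau n]; for large [i]
   these precede the next jump. *)
pose after := \bigcup_i \bigcap_(q : rat)
  (~` [set w | tau n w < ratr q < tau n w + i.+1%:R^-1] `|` B q).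
(* [pi < tau n] holds when [pi < q] for some rational [q] in [[0, tau n]]. *)
pose before := \bigcup_(q : rat) ([set w | ratr q <= tau n w] `&` ([set w | 0 <= (ratr q : R)] `&` B q)).
exists (after `\` before); split.
  apply: (@measurableD _ TG).
    apply: (@bigcup_measurable _ TG) => i _.
    rewrite -[X in measurable X]setCK setC_bigcap; apply: (@measurableC _ TG).
    apply: (@bigcupT_measurable_rat _ TG) => q; apply: (@measurableC _ TG).
    apply: (@measurableU _ TG); last exact: mB.
    apply: (@measurableC _ TG).
    rewrite (_ : [set w | _] = [set w | tau n w < ratr q] `&`
        [set w | ratr q < tau n w + i.+1%:R^-1]).
      apply: (@measurableI _ TG); apply: (@measurable_set_lt _ TG) => //.
      exact: measurable_funD.
    by apply/seteqP; split => w /= => [/andP[]//|[-> ->]].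
  apply: (@bigcupT_measurable_rat _ TG) => q.
  apply: (@measurableI _ TG); first exact: (@measurable_set_le _ TG).
  apply: (@measurableI _ TG); last exact: mB.
  exact: (@measurable_set_le _ TG).
move=> w nw.
have beforeP : before w <-> (pi w < (tau n w)%:E)%E.
  split=> [[q _ [/= qn [q0 Bq]]]|piw].
    have /(_ q0 w (le_lt_trans qn nw))[_ /(_ Bq)] := (HB q).2.
    by move/lt_le_trans; apply; rewrite lee_fin.
  have [r pr] : exists r, pi w = r%:E.
    by move: piw (pi0 w); case: (pi w) => // r _ _; exists r.
  move: piw; rewrite pr lte_fin => rn.
  have [q] := rat_in_itvoo rn; rewrite in_itv/= => /andP[rq qn].
  have q0 : 0 <= ratr q :> R.
    by rewrite (le_trans _ (ltW rq))// -lee_fin -pr.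
  exists q => //; split; first exact: ltW.
  split => //; apply/((HB q).2 q0 w (lt_trans qn nw)).
  by rewrite pr lte_fin.
have n0 := jump_time_ge0 X01 E0 n w.
have afterP : after w <-> (pi w <= (tau n w)%:E)%E.
  split=> [[i _ Hi]|piw].
    rewrite leNgt; apply/negP => piw.
    have [r nr rp] : exists2 r, tau n w < r & (r%:E <= pi w)%E.
      move: piw; case: (pi w) => [r|_|//]; last first.
        by exists (tau n w + 1); rewrite ?ltrDl ?leey.
      by rewrite lte_fin => nr; exists r.
    have [|q] := @rat_in_itvoo _ (tau n w)
      (Num.min (Num.min r (tau n.+1 w)) (tau n w + i.+1%:R^-1)).
      by rewrite !lt_min nr nw ltrDl invr_gt0 ltr0n.
    rewrite in_itv/= !lt_min => /andP[nq /andP[/andP[qr qn] qi]].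
    have q0 : 0 <= ratr q :> R by rewrite (le_trans n0)// ltW.
    have [|Bq] := Hi q I; first by rewrite /= nq qi.
    have := ((HB q).2 q0 w qn).2 Bq; rewrite ltNge (le_trans _ rp)//.
    by rewrite lee_fin ltW.
  have [i ni] := ltr_add_invr nw.
  exists i => // q _; have [/andP[nq qi]|] := boolP (tau n w < ratr q < tau n w + i.+1%:R^-1).
    right; apply/((HB q).2 _ w (lt_trans qi ni)).
      by rewrite (le_trans n0)// ltW.
    by rewrite (le_lt_trans piw)// lte_fin.
  by move=> /negP nH; left.
split=> [piw|[/afterP piw nb]].
  by split; [apply/afterP; rewrite piw|move/beforeP; rewrite piw ltxx].
by apply/le_anti; rewrite piw/= leNgt; apply/negP => /beforeP.
Qed.

End determined.

(** * The Markov chain at the jump times *)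

Section good_paths.
Context d (Omega : measurableType d) (R : realType).
Variables (X E : nat -> Omega -> R).
Hypothesis X01 : forall n w, 0 <= X n w <= 1.
Hypothesis E0 : forall n w, 0 <= E n w.
Local Notation S := (state 1 X).
Local Notation tau := (jump_time 1 X E).
Local Notation Z := (record_process 1 X E).

(* [(T - t) R_t] at the jump times, see [chainE]; unlike [tau] it involves no
   division. *)
Fixpoint chain (T : R) (n : nat) (w : Omega) : R :=
  if n is m.+1 then (chain T m w - E m w) * X m w else T.

(** Almost sure by [good_ae]. On these paths the records are exactly the jumps of positive index, at
    distinct times. *)
Definition good : set Omega := [set w | forall n, 0 < X n w < 1 /\ 0 < E n w].

Variable w : Omega.
Hypothesis good_w : good w.

Lemma good_state_gt0 n : 0 < S n w.
Proof.
elim: n => [|n IH]; first by rewrite /state big_ord0 mulr1.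
by rewrite stateS mulr_gt0//; have [/andP[]] := good_w n.
Qed.

Lemma good_state_lt m n : (m < n)%N -> S n w < S m w.
Proof.
move=> mn; apply: le_lt_trans (state_noninc X01 w mn) _.
by rewrite stateS gtr_pMr ?good_state_gt0//; have [/andP[]] := good_w m.
Qed.

Lemma good_jump_timeS n : tau n w < tau n.+1 w.
Proof.
by rewrite jump_timeS ltrDl divr_gt0// ?good_state_gt0//; have [_] := good_w n.
Qed.

Lemma good_jump_time_lt m n : (tau m w < tau n w) = (m < n)%N.
Proof.
apply/idP/idP; first exact: jump_time_lt.
by move=> mn; apply: lt_le_trans (good_jump_timeS m) _; exact: jump_time_nondec.
Qed.

Lemma good_jump_time_inj m n : tau m w = tau n w -> m = n.
Proof.
by move=> mn; have := good_jump_time_lt m n; have := good_jump_time_lt n m;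
  rewrite mn ltxx; case: ltngtP.
Qed.

Lemma good_process n t : tau n w <= t < tau n.+1 w -> Z t w = S n w.
Proof. by move=> nt; apply: record_processE. Qed.

Lemma good_process_jump n : Z (tau n w) w = S n w.
Proof. by apply: good_process; rewrite lexx good_jump_timeS. Qed.

Lemma good_record_atP t : record_at Z t w <-> exists2 n, (0 < n)%N & tau n w = t.
Proof.
rewrite record_atP//; split=> [[t0 [m [mt _]]]|[n n0 <-]].
  by exists m => //; move: t0; rewrite -mt -(jump_time0 X E w) good_jump_time_lt.
split; first by rewrite -(jump_time0 X E w) good_jump_time_lt.
by exists n; split=> // k; rewrite good_jump_time_lt; exact: good_state_lt.
Qed.

Variable T : R.

Lemma chainE n : chain T n w = (T - tau n w) * S n w.
Proof.
elim: n => [|n IH] /=; first by rewrite jump_time0 /state big_ord0 subr0 !mulr1.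
rewrite IH jump_timeS stateS; by field; rewrite gt_eqF ?good_state_gt0.
Qed.

Lemma chain_gt0 n : (0 < chain T n w) = (tau n w < T).
Proof. by rewrite chainE pmulr_lgt0 ?good_state_gt0// subr_gt0. Qed.

Lemma chain_lt n : (chain T n w < E n w) = (T < tau n.+1 w).
Proof. by rewrite chainE -ltr_pdivlMr ?good_state_gt0// jump_timeS ltrBlDl. Qed.

Lemma chain_le n : (chain T n w <= E n w) = (T <= tau n.+1 w).
Proof. by rewrite chainE -ler_pdivlMr ?good_state_gt0// jump_timeS lerBlDl. Qed.

(** The inequality with [E n] is strict: a next jump exactly at [T] would already lower [Z T]. *)
Lemma good_successP pi : success Z T pi w <->
  exists n, [/\ (0 < n)%N, pi w = (tau n w)%:E & 0 < chain T n w < E n w].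
Proof.
split=> [[t [pt tT /good_record_atP[n n0 nt] ZT]]|[n [n0 pn /andP[]]]].
  exists n; rewrite n0 pt nt chain_gt0 chain_lt nt tT; split=> //.
  rewrite ltNge; apply/negP => nT; have := process_le X01 nT.
  by rewrite -ZT -nt good_process_jump leNgt good_state_lt.
rewrite chain_gt0 chain_lt => nT Tn; exists (tau n w); split=> //.
  by apply/good_record_atP; exists n.
by rewrite good_process_jump (@good_process n)// Tn ltW.
Qed.

Lemma good_policyP s : success Z T (policy Z T s) w <->
  exists n, [/\ (0 < n)%N, forall k, (0 < k < n)%N -> s < chain T k w,
    chain T n w <= s & 0 < chain T n w < E n w].
Proof.
rewrite good_successP; split=> -[n].
  move=> [n0 pn YE]; exists n.
  have [u Au _] : exists2 u, [/\ record_at Z u w, u < T & (T - u) * Z u w <= s] & u <= tau n w.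
    by apply/(policy_leP X01 E0); rewrite pn.
  have [v [[rv vT vs] pv v_min]] := policy_attained X01 E0 Au.
  have vn : v = tau n w by apply: EFin_inj; rewrite -pv -pn.
  split=> //; last by rewrite chainE -good_process_jump -vn.
  move=> k /andP[k0 kn]; rewrite ltNge; apply/negP => Yk.
  have := v_min (tau k w); rewrite vn => H.
  suff : tau n w <= tau k w by rewrite leNgt good_jump_time_lt kn.
  apply: H; split; first by apply/good_record_atP; exists k.
    by rewrite (lt_trans (_ : _ < tau n w)) ?good_jump_time_lt// -vn.
  by rewrite good_process_jump -chainE.
move=> [n0 Yk Yn /andP[Y0 YE]]; exists n; split=> //; last by rewrite Y0 YE.
have An : [/\ record_at Z (tau n w) w, tau n w < T & (T - tau n w) * Z (tau n w) w <= s].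
  split; [by apply/good_record_atP; exists n|by rewrite -chain_gt0|].
  by rewrite good_process_jump -chainE.
have [v [[/good_record_atP[m m0 mv] vT vs] pv v_min]] := policy_attained X01 E0 An.
rewrite pv -mv; congr (_ %:E); congr (tau _ w).
have : (m <= n)%N by rewrite leqNgt -good_jump_time_lt -leNgt mv; exact: v_min.
rewrite leq_eqVlt => /predU1P[//|mn]; have := Yk m; rewrite m0 mn => /(_ isT).
by rewrite ltNge chainE -good_process_jump mv vs.
Qed.

(** In contrast to [good_successP], a second jump exactly at [T] is allowed, as only records before
    [T] are counted; hence the weak inequality. *)
Lemma good_one_recordP : (exists! t, record_at Z t w /\ t < T) <->
  0 < chain T 1 w <= E 1 w.
Proof.
rewrite chain_gt0 chain_le; split.
  move=> [t [[/good_record_atP[n n0 nt] tT] uniq_t]].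
  have t1 : tau 1 w < T.
    by rewrite (le_lt_trans _ tT)// -nt; apply: jump_time_nondec.
  rewrite t1/= leNgt; apply/negP => t2.
  have r k : (0 < k)%N -> tau k w < T -> t = tau k w.
    by move=> k0 kT; apply: uniq_t; split=> //; apply/good_record_atP; exists k.
  have /good_jump_time_inj// : tau 1 w = tau 2 w by rewrite -r// -r.
move=> /andP[t1 t2]; exists (tau 1 w); split.
  by split=> //; apply/good_record_atP; exists 1%N.
move=> t [/good_record_atP[n n0 <-] nT]; congr (tau _ w).
have : tau n w < tau 2 w by exact: lt_le_trans nT t2.
by rewrite good_jump_time_lt; case: n n0 {nT} => [|[|]].
Qed.

End good_paths.

(** * Independence of the next coordinate from the past *)

Section coordinates.
Context d (Omega : measurableType d) (R : realType) (P : probability Omega R).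
Variable xi : nat -> {RV P >-> R}.

Definition cylinder (n : nat) : set (set Omega) :=
  [set A | exists2 B : nat -> set R, (forall i, measurable (B i)) &
    A = \bigcap_(i in `I_n) xi i @^-1` B i].

Definition past (n : nat) : set (set Omega) := <<s cylinder n >>.
Definition pastType (n : nat) : measurableType _ := g_sigma_algebraType (cylinder n).

Hypothesis xi_indep : forall n (B : nat -> set R), (forall i, measurable (B i)) ->
  P (\bigcap_(i in `I_n) xi i @^-1` B i) = (\prod_(i < n) P (xi i @^-1` B i))%E.

Lemma cylinder_setI n : setI_closed (cylinder n).
Proof.
move=> _ _ [B mB ->] [C mC ->]; exists (fun i => B i `&` C i).
  by move=> i; exact: measurableI.
by rewrite -bigcapI; apply: eq_bigcapr => i _; rewrite preimage_setI.
Qed.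

Lemma measurable_preimage_xi i (B : set R) : measurable B -> measurable (xi i @^-1` B).
Proof. by move=> mB; rewrite -[X in measurable X]setTI; exact: (measurable_funP (xi i)). Qed.

Lemma cylinder_measurable n : cylinder n `<=` measurable.
Proof.
move=> _ [B mB ->]; apply: bigcap_measurableType => i _.
exact: measurable_preimage_xi.
Qed.

Lemma past_measurable n : past n `<=` measurable.
Proof. exact: smallest_sub (sigma_algebra_measurable _) (@cylinder_measurable n). Qed.

Lemma past_mono m n : (m <= n)%N -> past m `<=` past n.
Proof.
move=> mn; apply: smallest_sub; first exact: smallest_sigma_algebra.
move=> _ [B mB ->]; apply: sub_sigma_algebra.
exists (fun i => if (i < m)%N then B i else setT).
  by move=> i; case: ifP.
apply/seteqP; split => w H i /= i_lt.
  by case: ifP => // im; exact: H.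
by have := H i (leq_trans i_lt mn); rewrite /= i_lt.
Qed.

Lemma measurable_xi_past i n : (i < n)%N -> measurable_fun (setT : set (pastType n)) (xi i).
Proof.
move=> i_n _ B mB; rewrite setTI; apply: sub_sigma_algebra.
exists (fun j => if j == i then B else setT) => [j|]; first by case: ifP.
apply/seteqP; split => w H.
  by move=> j _ /=; case: eqP => // ->.
by have := H i i_n; rewrite /= eqxx.
Qed.

(** As functions of [A], both sides are finite measures. They agree on the cylinders, which are
    stable under intersection and generate [past n]. *)
Lemma past_indep n (A : set Omega) (C : set R) : past n A -> measurable C ->
  P (A `&` xi n @^-1` C) = (P A * P (xi n @^-1` C))%E.
Proof.
move=> pA mC; have mxC := measurable_preimage_xi n mC.
have pC_ge0 : 0 <= fine (P (xi n @^-1` C)) by exact: fine_ge0.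
pose m1 := mrestr P mxC; pose m2 := mscale (NngNum pC_ge0) P.
have -> : P (A `&` xi n @^-1` C) = m1 A by [].
have -> : (P A * P (xi n @^-1` C))%E = m2 A.
  by rewrite /m2 /mscale/= muleC fineK// fin_num_measure.
apply: (g_sigma_algebra_measure_unique (cylinder n) _ (fun=> setT)) pA.
- exact: cylinder_measurable.
- by move=> _; exists (fun=> setT) => //; apply/seteqP; split.
- by rewrite bigcup_const//; exists 0%N.
- exact: cylinder_setI.
- move=> _ [B mB ->]; rewrite /m1 /m2 /mrestr/= /mscale/= fineK ?fin_num_measure//.
  pose B' i := if i == n then C else B i.
  have mB' i : measurable (B' i) by rewrite /B'; case: ifP.
  have -> : mrestr P mxC (\bigcap_(i in `I_n) xi i @^-1` B i) =
      P (\bigcap_(i in `I_n.+1) xi i @^-1` B' i).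
    congr (P _); apply/seteqP; split => w.
      move=> [H wC] i /=; rewrite ltnS leq_eqVlt /B' => /predU1P[->|i_n]; first by rewrite eqxx.
      by rewrite ltn_eqF//; exact: H.
    move=> H; split; last by have := H n (ltnSn n); rewrite /B' eqxx.
    by move=> i i_n; have := H i (ltnW i_n); rewrite /B' ltn_eqF.
  rewrite xi_indep// xi_indep// big_ord_recr/= /B' eqxx muleC; congr (_ * _)%E.
  by apply: eq_bigr => i _; rewrite ltn_eqF.
- by move=> k; rewrite -ge0_fin_numE// fin_num_measure.
Qed.

Section step.
Variables (n : nat) (W : Omega -> R) (A : set Omega).
Hypothesis mW : measurable_fun (setT : set (pastType n)) W.
Hypothesis pA : past n A.
Local Open Scope ereal_scope.

Lemma past_measurable_fun d' (T' : measurableType d') (f : Omega -> T') :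
  measurable_fun (setT : set (pastType n)) f -> measurable_fun setT f.
Proof.
move=> mf _ B mB; apply: (@past_measurable n); exact: mf.
Qed.

(** Conditioning on the past. The indicator of [A] is made part of the past variable, so that
    [indep_integral] also covers integrals over [A]. *)
Lemma past_step (f : R * R -> \bar R) : measurable_fun setT f -> (forall z, 0 <= f z) ->
  \int[P]_(w in A) f (W w, xi n w) =
  \int[P]_(w in A) \int[distribution P (xi n)]_e f (W w, e).
Proof.
move=> mf f0.
pose V (w : Omega) : R * R := (\1_A w, W w).
have mV : measurable_fun (setT : set (pastType n)) V.
  by apply: measurable_fun_pair => //; exact: (@measurable_indic _ (pastType n)).
have mV' := past_measurable_fun mV.
pose V' : {RV P >-> (R * R)%type} := HB.pack V (isMeasurableFun.Build _ _ _ _ _ mV').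
(* The absolute value makes [g] nonnegative everywhere; on the values of [V] it changes nothing. *)
pose g (z : (R * R) * R) := (`|z.1.1|)%:E * f (z.1.2, z.2).
have mg : measurable_fun setT g.
  apply: emeasurable_funM.
    by apply/measurable_EFinP; do 2 apply: measurableT_comp => //.
  apply: (measurableT_comp mf); apply: measurable_fun_pair => //.
  exact: measurableT_comp.
have g0 z : 0 <= g z by rewrite mule_ge0// lee_fin.
have gE w e : g (V' w, e) = (\1_A w)%:E * f (W w, e) by rewrite /g/= ger0_norm.
have key := @indep_integral _ _ _ P _ _ V' (xi n) _ g mg g0.
rewrite integral_mkcond [RHS]integral_mkcond.
transitivity (\int[P]_w g (V' w, xi n w)).
  apply: eq_integral => w _; rewrite gE patchE indicE.
  by case: ifP => _; rewrite ?mul1e ?mul0e.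
rewrite key.
  apply: eq_integral => w _; rewrite patchE.
  under eq_integral do rewrite gE indicE.
  case: ifP => _; first by under eq_integral do rewrite mul1e.
  by apply: integral0_eq => e _; rewrite mul0e.
move=> B C mB mC; apply: past_indep => //.
by have := mV measurableT B mB; rewrite setTI.
Qed.

End step.
End coordinates.

Section record_chain.
Context d (Omega : measurableType d) (R : realType) (P : probability Omega R).
Variables (theta : R) (X E : nat -> {RV P >-> R}).
Hypothesis theta_gt0 : 0 < theta.
Hypothesis X_law : forall n A, measurable A -> distribution P (X n) A = beta1_prob theta A.
Hypothesis E_law : forall n A, measurable A -> distribution P (E n) A = exponential_prob 1 A.
Hypothesis XE_indep : mutually_independent P
  (fun i : (nat + nat)%type =>
     match i with inl n => X n : Omega -> R | inr n => E n : Omega -> R end).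

(* The variables in order of use: E_0, X_0, E_1, X_1, ... *)
Definition coordinate (k : nat) : {RV P >-> R} := if odd k then X k./2 else E k./2.

Lemma coordinate_indep n (B : nat -> set R) : (forall i, measurable (B i)) ->
  P (\bigcap_(i in `I_n) coordinate i @^-1` B i) =
  (\prod_(i < n) P (coordinate i @^-1` B i))%E.
Proof.
move=> mB; pose idx k : (nat + nat)%type := if odd k then inl k./2 else inr k./2.
pose code (i : (nat + nat)%type) := match i with inl k => k.*2.+1 | inr k => k.*2 end.
have codeK : cancel idx code.
  move=> k; rewrite /idx /code; have := odd_double_half k.
  by case: (odd k) => /= {2}<-.
have mBc i : measurable (B (code i)) by exact: mB.
have uniq_idx : uniq (map idx (iota 0 n)).
  by rewrite map_inj_uniq ?iota_uniq//; exact: can_inj codeK.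
have := XE_indep uniq_idx mBc; rewrite big_map.
have YE k : match idx k with inl n => X n : Omega -> R | inr n => E n : Omega -> R end =
    coordinate k by rewrite /idx /coordinate; case: ifP.
have -> : \bigcap_(i in [set` map idx (iota 0 n)])
    (match i with inl n => X n : Omega -> R | inr n => E n : Omega -> R end) @^-1` B (code i) =
    \bigcap_(i in `I_n) coordinate i @^-1` B i.
  apply/seteqP; split => w H.
    move=> k kn; have := H (idx k); rewrite /= YE codeK; apply.
    by apply: map_f; rewrite mem_iota.
  move=> _ /mapP[k + ->]; rewrite mem_iota add0n => /= kn.
  by rewrite /= YE codeK; exact: H.
move=> ->; rewrite -(big_mkord xpredT (fun i => P (coordinate i @^-1` B i))) /index_iota subn0.
by apply: eq_bigr => k _; rewrite YE codeK.
Qed.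

Lemma coordinate_even k : coordinate k.*2 = E k.
Proof. by rewrite /coordinate odd_double doubleK. Qed.

Lemma coordinate_odd k : coordinate k.*2.+1 = X k.
Proof. by rewrite /coordinate /= odd_double /= uphalf_double. Qed.

Local Notation past := (past coordinate).
Local Notation pastType := (pastType coordinate).
Local Notation chain := (chain X E).

Lemma measurable_X_past j n : (j.*2.+1 < n)%N -> measurable_fun (setT : set (pastType n)) (X j).
Proof. by rewrite -(coordinate_odd j); exact: measurable_xi_past. Qed.

Lemma measurable_E_past j n : (j.*2 < n)%N -> measurable_fun (setT : set (pastType n)) (E j).
Proof. by rewrite -(coordinate_even j); exact: measurable_xi_past. Qed.

Lemma measurable_chain_past T k n : (k.*2 <= n)%N ->
  measurable_fun (setT : set (pastType n)) (chain T k).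
Proof.
elim: k => [_|k IH kn]; first exact: measurable_cst.
have kn' : (k.*2.+1 < n)%N by rewrite (leq_trans _ kn).
apply: measurable_funM; last exact: measurable_X_past.
apply: measurable_funB; last by apply: measurable_E_past; exact: ltnW.
by apply: IH; exact: ltnW (ltnW kn').
Qed.

Lemma measurable_chain T k : measurable_fun setT (chain T k).
Proof. exact: past_measurable_fun (measurable_chain_past T (leqnn k.*2)). Qed.

Local Open Scope ereal_scope.

(** The Markov property: [past_step] integrates out [X k], coordinate [k.*2.+1], and then [E k],
    coordinate [k.*2]. *)
Lemma chain_step T k (A : set Omega) (U : R -> \bar R) : past k.*2 A ->
  measurable_fun setT U -> (forall y, 0 <= U y) ->
  \int[P]_(w in A) U (chain T k.+1 w) =
  \int[P]_(w in A) KE (distribution P (E k)) (KX (distribution P (X k)) U) (chain T k w).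
Proof.
move=> pA mU U0; have mc := measurable_chain_past T (leqnn k.*2).
have mc' : measurable_fun (setT : set (pastType k.*2.+1)) (fun w => chain T k w - E k w)%R.
  apply: measurable_funB; first exact: measurable_chain_past.
  exact: measurable_E_past.
have mKX : measurable_fun setT (KX (distribution P (X k)) U) by exact: measurable_KX.
have KX0 y : 0 <= KX (distribution P (X k)) U y by exact: KX_ge0.
have := past_step coordinate_indep mc' (past_mono (leqnSn _) pA)
  (f := fun z => U (z.1 * z.2)%R).
rewrite coordinate_odd /= => ->//; last by apply: (measurableT_comp mU); exact: measurable_funM.
have := past_step coordinate_indep mc pA
  (f := fun z => KX (distribution P (X k)) U (z.1 - z.2)%R).
rewrite coordinate_even /= => ->//.
by apply: (measurableT_comp mKX); exact: measurable_funB.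
Qed.

(** The flag [b] serves the strict comparison of [good_successP] and the weak one of
    [good_one_recordP]; the exponential law has no atoms, so the result is the same. *)
Lemma no_jump T k (A : set Omega) (b : bool) : past k.*2 A ->
  P (A `&` [set w | (0 < chain T k w)%R /\ (chain T k w < E k w ?<= if b)%R]) =
  \int[P]_(w in A) (no_record (chain T k w))%:E.
Proof.
move=> pA; have mA := past_measurable pA.
have mc := measurable_chain_past T (leqnn k.*2).
pose D : set (R * R) := [set z | (0 < z.1)%R /\ (z.1 < z.2 ?<= if b)%R].
have mD : measurable D.
  rewrite (_ : D = [set z | (0 < z.1)%R] `&` [set z | (z.1 < z.2 ?<= if b)%R])//.
  apply: measurableI; first exact: measurable_set_lt.
  by case: b {D}; [exact: measurable_set_le|exact: measurable_set_lt].
have := past_step coordinate_indep mc pA (f := fun z => (\1_D z)%:E).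
rewrite coordinate_even => step.
transitivity (\int[P]_(w in A) (\1_D (chain T k w, E k w))%:E).
  have mB : measurable [set w | D (chain T k w, E k w)].
    have mp : measurable_fun setT (fun w => (chain T k w, E k w)).
      by apply: measurable_fun_pair => //; exact: measurable_chain.
    by have := mp measurableT D mD; rewrite setTI.
  rewrite setIC -(integral_indic _ mA mB); apply: eq_integral => w _.
  by rewrite !indicE; congr ((nat_of_bool _)%:R%:E); apply/idP/idP; rewrite !inE.
rewrite step//; last by apply/measurable_EFinP; exact: measurable_indic.
apply: eq_integral => w _; set y := chain T k w.
have [y0|y0] := leP y 0%R.
  rewrite no_record_le0//; apply: integral0_eq => e _.
  by rewrite indicE memNset// /D/= => -[]; rewrite ltNge y0.
rewrite no_recordE//.
rewrite (integral_nuE (E_law k)); last 2 first.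
- apply/measurable_EFinP.
  have mi : measurable_fun setT (\1_D : R * R -> R) by exact: measurable_indic.
  exact: (measurableT_comp mi (measurable_fun_pair (measurable_cst y) (@measurable_id _ R setT))).
- by move=> e; rewrite lee_fin.
rewrite -[in RHS](mul1r (expR (- y))) -integral_exp_tail//.
transitivity (\int[lebesgue_measure]_(t in [set` Interval (BSide b y) +oo%O]) (1 * expR (- t))%:E).
  rewrite integral_mkcond [RHS]integral_mkcond; apply: eq_integral => e _.
  rewrite !patchE indicE !mem_setE !in_itv/= !andbT.
  have -> : ((y, e) \in D) = (y < e ?<= if b)%R.
    by apply/idP/idP; rewrite inE /D/=; [case|split].
  have [ye|ye] := boolP (y < e ?<= if b)%R; last by rewrite mul0e; case: ifP.
  by rewrite (lt_le_trans y0 (lteifW ye)) mul1e mul1r.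
case: b {D mD step} => //; rewrite -integral_itv_obnd_cbnd//.
apply/measurable_EFinP/measurable_funTS/measurable_funM => //.
exact: measurableT_comp.
Qed.

Local Close Scope ereal_scope.

Lemma good_ae (A B : set Omega) : measurable A -> measurable B ->
  (forall w, good X E w -> A w <-> B w) -> P A = P B.
Proof.
move=> mA mB AB.
pose bad n := X n @^-1` (~` `]0, 1[) `|` E n @^-1` (~` `]0, +oo[).
have mbad n : measurable (bad n).
  by apply: measurableU; apply: measurable_preimage_xi; exact: measurableC.
have bad0 n : P (bad n) = 0%E.
  apply/eqP; rewrite eq_le measure_ge0 andbT.
  rewrite (le_trans (measureU2 _ _ _))//; try by apply: measurable_preimage_xi; exact: measurableC.
  have ind (nu : probability R R) (C : set R) : measurable C ->
      nu (~` C) = (\int[nu]_x (\1_(~` C) x)%:E)%E.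
    by move=> mC; rewrite integral_indic ?setIT//; exact: measurableC.
  (* Both laws integrate over the interval in question, where the indicator of its complement
     vanishes. *)
  have z0 (C : set R) (g : R -> \bar R) :
      (\int[lebesgue_measure]_(x in C) ((\1_(~` C) x)%:E * g x) = 0)%E.
    by apply: integral0_eq => x Cx; rewrite indicE memNset ?mul0e//; exact.
  rewrite -[X in (X + _)%E]/(distribution P (X n) _) -[X in (_ + X)%E]/(distribution P (E n) _).
  rewrite !ind// (integral_nuX theta_gt0 (X_law n)) ?(integral_nuE (E_law n)).
  - by rewrite !z0 adde0.
  - by apply/measurable_EFinP/measurable_indic; exact: measurableC.
  - by move=> x; rewrite lee_fin.
  - by apply/measurable_EFinP/measurable_indic; exact: measurableC.
  - by move=> x; rewrite lee_fin.
have mN : measurable (\bigcup_n bad n) by exact: bigcup_measurable.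
have N0 : P (\bigcup_n bad n) = 0%E.
  apply/eqP; rewrite eq_le measure_ge0 andbT.
  rewrite (le_trans (generalized_Boole_inequality P mbad mN))//.
  by rewrite eseries0// => n _ _; exact: bad0.
have goodN w : ~ (\bigcup_n bad n) w -> good X E w.
  move=> nbad n; have : ~ bad n w by move=> bn; apply: nbad; exists n.
  move=> /not_orP[/contrapT + /contrapT]; rewrite /= !in_itv/= andbT.
  by move=> X01' E0'.
have PD (C : set Omega) : measurable C -> P C = P (C `\` \bigcup_n bad n).
  move=> mC; rewrite measureD//; last by rewrite -ge0_fin_numE// fin_num_measure.
  rewrite [X in (_ - X)%E](_ : _ = 0%E) ?sube0//.
  apply/eqP; rewrite eq_le measure_ge0 andbT -N0.
  by apply: le_measure; rewrite ?inE//; exact: measurableI.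
rewrite (PD A)// (PD B)//; congr (P _); apply/seteqP; split => w [wA wN]; split=> //;
  exact/(AB w (goodN w wN)).
Qed.

End record_chain.

(** * Telescoping along the jumps *)

Section stopping_rule.
Context d (Omega : measurableType d) (R : realType) (P : probability Omega R).
Variables (theta : R) (X E : nat -> {RV P >-> R}).
Hypothesis theta_gt0 : 0 < theta.
Hypothesis X01 : forall n w, 0 <= X n w <= 1.
Hypothesis E0 : forall n w, 0 <= E n w.
Hypothesis X_law : forall n A, measurable A -> distribution P (X n) A = beta1_prob theta A.
Hypothesis E_law : forall n A, measurable A -> distribution P (E n) A = exponential_prob 1 A.
Hypothesis XE_indep : mutually_independent P
  (fun i : (nat + nat)%type =>
     match i with inl n => X n : Omega -> R | inr n => E n : Omega -> R end).
Local Notation past := (past (coordinate X E)).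
Local Notation chain := (chain X E).
Variables (T s : R).
Hypotheses (T_gt0 : 0 < T) (s_gt0 : 0 < s).
Local Notation value := (value theta s).
Local Notation reward := (reward theta s).

(* [D n] is the event that the rule stops at the [n]-th jump if it has not
   stopped before. *)
Variable D : nat -> set Omega.
Hypothesis pD : forall n, past n.*2 (D n).

(** Stopping starts at jump 1, as time 0 is not a record time. Hence the shift by one: [stops_at n]
    means stopping at jump [n.+1]. *)
Fixpoint continuing (n : nat) : set Omega :=
  if n is m.+1 then continuing m `\` D m.+1 else setT.

Definition stops_at (n : nat) : set Omega := continuing n `&` D n.+1.

Definition wins_at (n : nat) : set Omega := stops_at n `&`
  [set w | 0 < chain T n.+1 w /\ chain T n.+1 w < E n.+1 w].

Lemma past_continuing n : past n.*2 (continuing n).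
Proof.
elim: n => [|n IH]; first exact: (@measurableT _ (pastType (coordinate X E) 0)).
apply: (@measurableD _ (pastType (coordinate X E) n.+1.*2)); last exact: pD.
by apply: past_mono IH; rewrite leq_double.
Qed.

Lemma past_stops_at n : past n.+1.*2 (stops_at n).
Proof.
apply: (@measurableI _ (pastType (coordinate X E) n.+1.*2)); last exact: pD.
by apply: past_mono (@past_continuing n); rewrite leq_double.
Qed.

Lemma measurable_continuing n : measurable (continuing n).
Proof. exact: (past_measurable (@past_continuing n)). Qed.

Lemma measurable_stops_at n : measurable (stops_at n).
Proof. exact: (past_measurable (@past_stops_at n)). Qed.

Lemma measurable_wins_at n : measurable (wins_at n).
Proof.
apply: measurableI; first exact: measurable_stops_at.
rewrite (_ : [set w | _] = [set w | 0 < chain T n.+1 w] `&`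
    [set w | chain T n.+1 w < E n.+1 w])//.
by apply: measurableI; apply: measurable_set_lt => //; exact: measurable_chain.
Qed.

Lemma continuingP n w : continuing n w <-> forall k, (0 < k <= n)%N -> ~ D k w.
Proof.
elim: n => [|n IH]; first by split=> // _ k /andP[k0]; rewrite leqNgt k0.
split=> [[/IH Hn nD] k|H].
  by rewrite [(_ <= n.+1)%N]leq_eqVlt => /andP[k0 /predU1P[->//|kn]]; apply: Hn; rewrite k0.
split; last by apply: H; rewrite ltnSn.
by apply/IH => k /andP[k0 kn]; apply: H; rewrite k0 leqW.
Qed.

Lemma trivIset_stops_at : trivIset setT stops_at.
Proof.
apply/trivIsetP => i j _ _; wlog ij : i j / (i < j)%N.
  move=> H; rewrite neq_ltn => /orP[|] ij; first by apply: H; rewrite ?ltn_eqF.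
  by rewrite setIC; apply: H; rewrite ?ltn_eqF.
move=> _; apply/seteqP; split => w //= -[[_ Dw] [/continuingP H _]].
by apply: (H i.+1) Dw; rewrite ltnS ij.
Qed.

Local Open Scope ereal_scope.

Definition gain n := \int[P]_(w in stops_at n) (no_record (chain T n.+1 w))%:E.
(** The probability of winning after jump [n] if the threshold rule took over there. *)
Definition rest n := \int[P]_(w in continuing n) (value (chain T n w))%:E.

Let gain_ge0 n : 0 <= gain n.
Proof. by apply: integral_ge0 => w _; rewrite lee_fin no_record_ge0. Qed.

Let value_ge0 y : 0 <= (value y)%:E.
Proof.
by rewrite lee_fin; have /andP[] := value_bounds theta_gt0 (X_law 0) (E_law 0) s_gt0 y.
Qed.

Let reward_ge0 y : 0 <= (reward y)%:E.
Proof.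
by rewrite lee_fin; have /andP[] := reward_bounds theta_gt0 (X_law 0) (E_law 0) s_gt0 y.
Qed.

Let mreward n (A : set Omega) : measurable_fun A (fun w => (reward (chain T n w))%:E).
Proof.
apply/measurable_funTS/measurable_EFinP.
exact: (measurableT_comp (measurable_reward _ _) (measurable_chain X E T n)).
Qed.

Let mvalue n (A : set Omega) : measurable_fun A (fun w => (value (chain T n w))%:E).
Proof.
apply/measurable_funTS/measurable_EFinP.
exact: (measurableT_comp (measurable_value theta_gt0 (X_law 0) s_gt0) (measurable_chain X E T n)).
Qed.

Let mno_record n (A : set Omega) : measurable_fun A (fun w => (no_record (chain T n w))%:E).
Proof.
apply/measurable_funTS/measurable_EFinP.
exact: (measurableT_comp (@measurable_no_record R) (measurable_chain X E T n)).
Qed.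

Lemma win_probability : P (\bigcup_n wins_at n) = \sum_(n <oo) gain n.
Proof.
rewrite measure_bigcup//; last 2 first.
- by move=> n _; exact: measurable_wins_at.
- apply/trivIsetP => i j _ _ ij; have /trivIsetP/(_ i j I I ij) := trivIset_stops_at.
  by move=> /seteqP[H _]; apply/seteqP; split => w // [[wi _] [wj _]]; exact: (H w).
rewrite (@eq_eseriesl _ _ xpredT); last by move=> n; rewrite in_setT.
apply: eq_eseriesr => n _.
have H := no_jump E_law XE_indep T (A := stops_at n) (k := n.+1) false (@past_stops_at n).
exact: H.
Qed.

(** [chain_step] and the fixed-point equation replace the value at jump [n] by the reward at jump
    [n.+1]; the domain is then split by whether the rule stops there. *)
Let rest_step n : rest n =
  \int[P]_(w in stops_at n) (reward (chain T n.+1 w))%:E +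
  \int[P]_(w in continuing n.+1) (reward (chain T n.+1 w))%:E.
Proof.
have mc k := measurable_continuing k.
have ms := measurable_stops_at n.
have disj : [disjoint stops_at n & continuing n.+1].
  by apply/disj_setPS => w [] [_ Dw] [_]; exact.
transitivity (\int[P]_(w in stops_at n `|` continuing n.+1) (reward (chain T n.+1 w))%:E); last first.
  apply: ge0_integral_setU; [exact: ms|exact: mc|exact: mreward| |exact: disj].
  by move=> w _; exact: reward_ge0.
have -> : stops_at n `|` continuing n.+1 = continuing n.
  apply/seteqP; split => w; first by case=> -[].
  by move=> Hw; have [Dw|nDw] := pselect (D n.+1 w); [left|right].
have mr : measurable_fun setT (EFin \o reward).
  by apply/measurable_EFinP; exact: measurable_reward.
have := chain_step XE_indep T (@past_continuing n) mr reward_ge0.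
move=> /= ->; apply: eq_integral => w _.
by rewrite (KE_KX_reward theta_gt0 (X_law n) (E_law n) s_gt0).
Qed.

Let rest0 : rest 0 = (value T)%:E.
Proof. by rewrite /rest/= integral_cst// [X in _ * X]probability_setT mule1. Qed.

Lemma partial_gain_le : (forall y, (no_record y <= reward y)%R) ->
  (forall y, (value y <= reward y)%R) ->
  forall N, \sum_(0 <= n < N) gain n + rest N <= (value T)%:E.
Proof.
move=> h_le V_le; elim=> [|N IH]; first by rewrite big_geq// add0e rest0.
apply: le_trans IH; rewrite big_nat_recr; last exact: leq0n.
rewrite -addeA; apply: leeD2l; rewrite (rest_step N); apply: leeD.
  apply: (ge0_le_integral P (measurable_stops_at N)).
  - by move=> w _; rewrite lee_fin no_record_ge0.
  - exact: mno_record.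
  - exact: mreward.
  - by move=> w _; rewrite lee_fin.
apply: (ge0_le_integral P (measurable_continuing N.+1)).
- by move=> w _; exact: value_ge0.
- exact: mvalue.
- exact: mreward.
- by move=> w _; rewrite lee_fin.
Qed.

Lemma win_probability_le : (forall y, (no_record y <= reward y)%R) ->
  (forall y, (value y <= reward y)%R) -> P (\bigcup_n wins_at n) <= (value T)%:E.
Proof.
move=> h_le V_le; rewrite win_probability.
apply: lime_le; first by apply: is_cvg_nneseries => n _ _; exact: gain_ge0.
apply: nearW => N; apply: le_trans (partial_gain_le h_le V_le N).
by rewrite leeDl//; apply: integral_ge0.
Qed.

(** For the threshold rule nothing is lost: where it stops the reward equals [no_record], where it
    continues the reward equals [value]. *)
Lemma partial_gain_eq : (forall n w, D n w <-> (chain T n w <= s)%R) ->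
  forall N, \sum_(0 <= n < N) gain n + rest N = (value T)%:E.
Proof.
move=> DE; elim=> [|N IH]; first by rewrite big_geq// add0e rest0.
rewrite -IH big_nat_recr; last exact: leq0n.
rewrite -[LHS]addeA; congr (_ + _); rewrite (rest_step N); congr (_ + _).
  apply: eq_integral => w; rewrite inE => -[_ /DE Ys].
  have [y0|y0] := leP (chain T N.+1 w) 0%R.
    by rewrite no_record_le0// /reward early_late_le0.
  by rewrite no_recordE// /reward early_lateL ?y0.
apply: eq_integral => w; rewrite inE => -[_ nD].
have sY : (s < chain T N.+1 w)%R by rewrite ltNge; apply/negP => /DE.
by rewrite /value /reward !early_lateR.
Qed.

(** While positive, the chain stays below [T], so each further jump before the horizon needs a fresh
    clock of at most [T]. As [value] is at most 1 and vanishes once the horizon has passed, this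
    forces [rest N] to 0. *)
Lemma chain_pos_probability N :
  P [set w | (0 < chain T N w)%R] <= ((1 - expR (- T)) ^+ N)%:E.
Proof.
have mpos n : measurable [set w | (0 < chain T n w)%R].
  by apply: measurable_set_lt => //; exact: measurable_chain.
have ppos n : past n.*2 [set w | (0 < chain T n w)%R].
  apply: (@measurable_set_lt _ (pastType (coordinate X E) n.*2)) => //.
  exact: measurable_chain_past.
have chain_le n w : (0 < chain T n w)%R -> (chain T n w <= T)%R.
  elim: n => // n IH /= pos; have /andP[x0 x1] := X01 n w; have e0 := E0 n w.
  have y0 : (0 < chain T n w - E n w)%R.
    by rewrite ltNge; apply/negP => y0; move: pos; rewrite ltNge mulr_le0_ge0.
  have yT : (chain T n w <= T)%R by apply: IH; rewrite (lt_le_trans y0)// gerBl.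
  by rewrite (le_trans _ yT)// (@le_trans _ _ (chain T n w - E n w)%R) ?gerBl// ler_piMr// ltW.
have PE n : P (E n @^-1` `[0%R, T]) = (1 - expR (- T))%:E.
  have := E_law n (measurable_itv `[0%R, T]).
  by rewrite exponential_prob_itv0c// mulN1r.
elim: N => [|N IH].
  by rewrite expr0 (le_trans (probability_le1 _ _)).
rewrite exprSr EFinM; apply: (@le_trans _ _
    (P ([set w | (0 < chain T N w)%R] `&` E N @^-1` `[0%R, T]))).
  apply: le_measure; rewrite ?inE//.
    apply: measurableI => //; rewrite -[X in measurable X]setTI.
    exact: (measurable_funP (E N)).
  move=> w /= pos; have /andP[x0 x1] := X01 N w; have e0 := E0 N w.
  have y0 : (0 < chain T N w - E N w)%R.
    by rewrite ltNge; apply/negP => y0; move: pos; rewrite ltNge mulr_le0_ge0.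
  have cpos : (0 < chain T N w)%R by rewrite (lt_le_trans y0)// gerBl.
  split=> //; rewrite in_itv/= e0/=; apply: le_trans (chain_le N w cpos).
  by rewrite ltW// -subr_gt0.
have := past_indep (coordinate_indep XE_indep) (ppos N) (measurable_itv `[0%R, T]).
rewrite coordinate_even => ->; rewrite PE lee_wpmul2r// lee_fin subr_ge0.
by rewrite -expR0 ler_expR oppr_le0 ltW.
Qed.

Lemma win_probability_eq : (forall n w, D n w <-> (chain T n w <= s)%R) ->
  P (\bigcup_n wins_at n) = (value T)%:E.
Proof.
move=> DE; rewrite win_probability; apply/cvg_lim => //.
have q01 : (`|1 - expR (- T)| < 1)%R.
  rewrite ger0_norm ?subr_ge0 -?expR0 ?ler_expR ?oppr_le0 ?ltW//.
  by rewrite expR0 gtrBl expR_gt0.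
have restE N : rest N \is a fin_num /\ (fine (rest N) <= (1 - expR (- T)) ^+ N)%R /\
   (0 <= fine (rest N))%R.
  have r0 : 0 <= rest N by apply: integral_ge0.
  have rle : rest N <= ((1 - expR (- T)) ^+ N)%:E.
    apply: le_trans (chain_pos_probability N).
    have mpos : measurable [set w | (0 < chain T N w)%R].
      by apply: measurable_set_lt => //; exact: measurable_chain.
    rewrite -[X in P X]setIT -(integral_indic _ measurableT mpos).
    apply: (@le_trans _ _ (\int[P]_w (value (chain T N w))%:E)).
      by apply: ge0_subset_integral => //; exact: measurable_continuing.
    apply: ge0_le_integral => //.
      by apply/measurable_EFinP; exact: measurable_indic.
    move=> w _; rewrite lee_fin indicE; have [y0|y0] := leP (chain T N w) 0%R.
      by rewrite /value early_late_le0.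
    by rewrite mem_set//=; have /andP[] := value_bounds theta_gt0 (X_law 0) (E_law 0) s_gt0 (chain T N w).
  have rfin : rest N \is a fin_num by rewrite ge0_fin_numE// (le_lt_trans rle)// ltry.
  by split=> //; split; [rewrite -lee_fin fineK|exact: fine_ge0].
have -> : (fun N => \sum_(0 <= n < N) gain n) = (fun N => (value T - fine (rest N))%:E).
  apply/funext => N; have [rfin _] := restE N.
  by rewrite EFinB -(partial_gain_eq DE N) fineK// addeK.
rewrite -[X in _ --> X](_ : (value T - 0)%:E = _); last by rewrite subr0.
apply: cvg_EFin; first exact: nearW.
apply: cvgB; first exact: cvg_cst.
apply: (@squeeze_cvgr _ _ _ _ (cst 0%R) (fun N => (1 - expR (- T)) ^+ N)%R).
- by apply: nearW => N; have [_ [r1 r0]] := restE N; rewrite r0 r1.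
- exact: cvg_cst.
- exact: cvg_expr.
Qed.

End stopping_rule.

(** * From the chain back to the record process *)

Section last_record.
Context d (Omega : measurableType d) (R : realType) (P : probability Omega R).
Variables (theta : R) (X E : nat -> {RV P >-> R}).
Hypothesis theta_gt0 : 0 < theta.
Hypothesis X01 : forall n w, 0 <= X n w <= 1.
Hypothesis E0 : forall n w, 0 <= E n w.
Hypothesis X_law : forall n A, measurable A -> distribution P (X n) A = beta1_prob theta A.
Hypothesis E_law : forall n A, measurable A -> distribution P (E n) A = exponential_prob 1 A.
Hypothesis XE_indep : mutually_independent P
  (fun i : (nat + nat)%type =>
     match i with inl n => X n : Omega -> R | inr n => E n : Omega -> R end).
Local Notation Z := (record_process 1 X E).
Local Notation past := (past (coordinate X E)).
Local Notation pastType := (pastType (coordinate X E)).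
Local Notation chain := (chain X E).

Let mX n : measurable_fun setT (X n). Proof. exact: measurable_funP. Qed.
Let mE n : measurable_fun setT (E n). Proof. exact: measurable_funP. Qed.

Lemma one_record_probE (T : R) : 0 < T -> one_record_prob P Z T = single_record theta T.
Proof.
move=> T0; rewrite /one_record_prob.
have pT : past 1.*2 setT by exact: (@measurableT _ (pastType 1.*2)).
have pT0 : past 0.*2 setT by exact: (@measurableT _ (pastType 0.*2)).
have mh : measurable_fun setT (EFin \o @no_record R).
  by apply/measurable_EFinP; exact: measurable_no_record.
have h0 y : (0 <= (EFin \o @no_record R) y)%E by rewrite lee_fin no_record_ge0.
have H := no_jump E_law XE_indep T true pT.
rewrite (@good_ae _ _ _ _ _ _ _ theta_gt0 X_law E_law _
   (setT `&` [set w | 0 < chain T 1 w /\ chain T 1 w < E 1 w ?<= if true])).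
- rewrite H; have /= -> := chain_step XE_indep T pT0 mh h0.
  rewrite (eq_integral (cst (single_record theta T)%:E)); last first.
    by move=> w _; exact: (KE_laplace theta_gt0 (X_law 0) (E_law 0)).
  by rewrite integral_cst// [X in fine (_ * X)%E]probability_setT mule1.
- exact: measurable_one_record.
- rewrite setTI (_ : [set w | _] = [set w | 0 < chain T 1 w] `&` [set w | chain T 1 w <= E 1 w])//.
  apply: measurableI; first by apply: measurable_set_lt => //; exact: measurable_chain.
  by apply: measurable_set_le => //; exact: measurable_chain.
- move=> w gw; rewrite /= good_one_recordP//.
  by split=> [/andP[]//|[_ []] -> ->].
Qed.

Variables (T s : R).
Hypotheses (T_gt0 : 0 < T) (s_gt0 : 0 < s).

Lemma policy_valueE : policy_value P Z T s = (value theta s T)%:E.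
Proof.
(* This rule also stops at jumps past the horizon, where the policy does not; such a stop never
   wins, so the winning events agree. *)
pose D n := [set w | chain T n w <= s].
have pD n : past n.*2 (D n).
  by apply: (@measurable_set_le _ (pastType n.*2)) => //; exact: measurable_chain_past.
rewrite -(win_probability_eq theta_gt0 X01 E0 X_law E_law XE_indep T_gt0 s_gt0 pD) => [|//].
apply: (good_ae theta_gt0 X_law E_law).
- apply: measurable_success => //.
  apply: (stopping_time_measurable X01 mX mE); exact: policy_stopping_time.
- by apply: bigcup_measurable => n _; exact: measurable_wins_at.
- move=> w gw; rewrite good_policyP//; split=> [[n [n0 Yk Yn /andP[Y0 YE]]]|].
    case: n n0 Yk Yn Y0 YE => // n _ Yk Yn Y0 YE.
    exists n => //; split; last by [].
    split=> //; apply/continuingP => k /andP[k0 kn] /=.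
    by apply/negP; rewrite -ltNge Yk// k0 ltnS.
  move=> [n _ [[/continuingP cn Yn] /= [Y0 YE]]]; exists n.+1; split=> //; last by rewrite Y0 YE.
  by move=> k /andP[k0 kn]; rewrite ltNge; apply/negP; apply: cn; rewrite k0 -ltnS.
Qed.

(** A stopping time can win only at a jump. On good paths [D n] is the event that it stops at jump
    [n], so its success is a win of the corresponding rule, to which the telescoped bound
    applies. *)
Lemma success_probability_le (pi : Omega -> \bar R) : int_exp_laplace theta s = 1 ->
  stopping_time Z pi -> (P (success Z T pi) <= (value theta s T)%:E)%E.
Proof.
move=> s_root spi.
have HD n : exists D, past n.*2 D /\
    forall w, jump_time 1 X E n w < jump_time 1 X E n.+1 w ->
      pi w = (jump_time 1 X E n w)%:E <-> D w.
  apply: (stopping_determined X01 E0) => // j jn.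
    by apply: measurable_X_past; rewrite -doubleS leq_double.
  by apply: measurable_E_past; rewrite ltn_double.
have {HD}[D HD] := choice HD.
have pD n : past n.*2 (D n) by have [] := HD n.
apply: le_trans (win_probability_le theta_gt0 X_law E_law XE_indep T s_gt0 pD _ _); last 2 first.
- by move=> y; exact: (no_record_le_reward theta_gt0 (X_law 0) s_gt0 s_root).
- by move=> y; exact: (value_le_reward theta_gt0 (X_law 0) s_gt0 s_root).
rewrite le_eqVlt; apply/orP; left; apply/eqP.
apply: (good_ae theta_gt0 X_law E_law).
- apply: measurable_success => //; exact: (stopping_time_measurable X01 mX mE).
- by apply: bigcup_measurable => n _; exact: measurable_wins_at.
- move=> w gw; have tS n := good_jump_timeS gw n.
  rewrite good_successP//; split=> [[n [n0 pn /andP[Y0 YE]]]|].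
    case: n n0 pn Y0 YE => // n _ pn Y0 YE.
    exists n => //; split; last by [].
    split; last exact/((HD n.+1).2 w (tS _)).
    apply/continuingP => k /andP[k0 kn] /((HD k).2 w (tS _)).
    by rewrite pn => -[] /esym/(good_jump_time_inj X01 E0 gw) kn'; move: kn; rewrite kn' ltnn.
  move=> [n _ [[_ Dn] /= [Y0 YE]]]; exists n.+1; split=> //; last by rewrite Y0 YE.
  exact/((HD n.+1).2 w (tS _)).
Qed.

End last_record.

Theorem mainTheorem4 (d : measure_display) (Omega : measurableType d)
  (R : realType) (P : probability Omega R) (theta : R)
  (X E : nat -> {RV P >-> R})
  (theta_gt0 : 0 < theta)
  (X_range : forall n w, 0 <= X n w <= 1)
  (E_range : forall n w, 0 <= E n w)
  (X_law : forall n A, measurable A -> distribution P (X n) A = beta1_prob theta A)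
  (E_law : forall n A, measurable A -> distribution P (E n) A = exponential_prob 1 A)
  (XE_indep : mutually_independent P
     (fun i : (nat + nat)%type =>
        match i with inl n => X n : Omega -> R | inr n => E n : Omega -> R end)) :
  let Z := record_process 1 X E in
  let v := policy_value P Z in
  let p1 := one_record_prob P Z in
  let is_root (s : R) :=
    ('E_P[fun w => ((expR (s * (1 - X 0%N w)) - 1) / (1 - X 0%N w))%R] = 1)%E in
  [/\ forall s, 0 < s ->
        [/\ p1 s = \int[lebesgue_measure]_(x in `[0, 1])
                     ((expR (- (s * x)) - expR (- s)) / (1 - x)
                      * (theta * x `^ (theta - 1))),
            derivable p1 s 1,
            p1^`()%classic s = - p1 s + theta / s `^ theta * inc_gamma theta 0%:E s%:E
          & forall T, s < T ->
              v T s = (inc_gamma (- theta + 1) s%:E T%:E * expR s * s `^ theta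
                       * p1^`()%classic s + p1 s)%:E],
      exists! s, 0 < s /\ is_root s
    & forall s, 0 < s -> is_root s ->
        let c := - s `^ theta + expR s * theta * inc_gamma theta 0%:E s%:E in
        (forall T, s <= T ->
           [/\ stopping_time Z (policy Z T s),
               optimal_value P Z T = v T s
             & v T s = (inc_gamma (- theta + 1) s%:E T%:E * c + expR (- s))%:E])
        /\ v T s @[T --> +oo] -->
             (inc_gamma (- theta + 1) s%:E +oo * c + expR (- s))%:E].
Proof.
move=> Z v p1 is_root.
have p1E (s : R) : 0 < s -> p1 s = single_record theta s.
  exact: (one_record_probE theta_gt0 X_range E_range X_law E_law XE_indep).
have d1 (s : R) : 0 < s -> is_derive s 1 p1 (- single_record theta s + laplace theta s).
  move=> s0; have ds := is_derive_single_record theta_gt0 (X_law 0) s0.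
  (* The two functions are known to agree only on positive arguments, which suffices near [s]. *)
  apply: near_eq_is_derive ds; near=> t; apply/esym/p1E.
  by near: t; exact: lt_nbhsr.
have vE (T s : R) : 0 < s -> 0 < T -> v T s = (value theta s T)%:E.
  move=> s0 T0.
  exact: (policy_valueE theta_gt0 X_range E_range X_law E_law XE_indep T0 s0).
have rootE (s : R) : 0 < s -> is_root s <-> int_exp_laplace theta s = 1.
  move=> s0; have I := integral_exp_ratio theta_gt0 (X_law 0) (E_law 0) s0.
  have mg : measurable_fun setT (fun x : R => ((expR (s * (1 - x)) - 1) / (1 - x))%:E).
    apply/measurable_EFinP; apply: measurable_funM.
      apply: measurable_funB => //; apply: measurableT_comp => //.
      by apply: measurable_funM => //; exact: measurable_funB.
    by apply: (measurableT_comp measurable_invr); exact: measurable_funB.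
  rewrite ge0_integral_distribution// in I.
    rewrite /is_root unlock I; split=> [[]//|->//].
  move=> x; rewrite lee_fin; have [x1|x1] := leP x 1.
    by rewrite divr_ge0 ?subr_ge0// -[leLHS]expR0 ler_expR mulr_ge0 ?subr_ge0// ltW.
  rewrite mulr_le0 ?invr_le0 ?subr_le0 ?(ltW x1)// -[leRHS]expR0 ler_expR.
  by rewrite pmulr_rle0// subr_le0 ltW.
have late (T s : R) : 0 < s -> s <= T -> v T s = (late_value theta s T)%:E.
  (* At [T = s] the value takes its early branch, which meets [late_value] there because the
     incomplete gamma integral is empty. *)
  move=> s0 sT; rewrite vE ?(lt_le_trans s0)// /value.
  move: sT; rewrite le_eqVlt => /predU1P[<-|sT]; last by rewrite early_lateR.
  by rewrite early_lateL ?s0/=// late_value_start.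
split.
- move=> s s0; split.
  + by rewrite p1E// (single_recordE theta_gt0 (X_law 0) (E_law 0)).
  + by have ds := d1 s s0; exact: ex_derive.
  + by have ds := d1 s s0; rewrite derive1E derive_val p1E.
  + move=> T sT; have ds := d1 s s0; rewrite late ?ltW// derive1E derive_val p1E//.
    by congr EFin; rewrite /late_value /value_slope; ring.
- have [s [s0 Is]] := int_exp_laplace_root theta_gt0 (X_law 0).
  exists s; split; first by split=> //; apply/(rootE s s0).
  move=> t [t0 /(rootE t t0) It].
  have := int_exp_laplace_incr theta_gt0 (X_law 0) s0 (y := t).
  have := int_exp_laplace_incr theta_gt0 (X_law 0) t0 (y := s).
  rewrite Is It ltxx; case: (ltgtP s t) => // _; first by move=> _ /(_ isT).
  by move=> /(_ isT).
- move=> s s0 /(rootE s s0) Is c.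
  have valE T : s <= T -> v T s = (inc_gamma (- theta + 1) s%:E T%:E * c + expR (- s))%:E.
    move=> sT; rewrite late// /late_value.
    by rewrite (value_slope_root s0 Is) (single_record_root Is).
  split=> [T sT|].
    have T0 : 0 < T by exact: lt_le_trans sT.
    have spol : stopping_time Z (policy Z T s).
      apply: (policy_stopping_time X_range E_range) => n; exact: measurable_funP.
    split; [exact: spol| |exact: valE].
    apply/le_anti/andP; split.
      apply: ge_ereal_sup => _ [pi spi <-]; rewrite vE//.
      exact: (success_probability_le theta_gt0 X_range E_range X_law E_law XE_indep T0 s0 Is).
    by apply: ereal_sup_ubound; exists (policy Z T s).
  apply: (@cvg_trans _ ((inc_gamma (- theta + 1) s%:E T%:E * c + expR (- s))%:E @[T --> +oo])).
    apply: near_eq_cvg; near=> T; apply/esym/valE.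
    by near: T; apply: nbhs_pinfty_ge; exact: num_real.
  apply: cvg_EFin; first exact: nearW.
  apply: cvgD; last exact: cvg_cst.
  by apply: cvgM; [exact: cvg_inc_gamma_upper|exact: cvg_cst].
Unshelve. all: by end_near. Qed.
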